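(* Let $T\in\mathcal{L}_{1,\infty}$ and $z\in\mathbb{C}$. All normalised traces on $\mathcal{L}_{1,\infty}$ take the value $z$ on the operator $T$ if and only if $$T-z\cdot{\rm diag}\Big(\Big\{\frac1{k+1}\Big\}_{k\geq0}\Big)\in[\mathcal{L}_{1,\infty},\mathcal{L}(H)].$$
   Context: $H$ is a separable infinite-dimensional Hilbert space, $\mathcal{L}(H)$ its algebra of bounded operators, $\mu(k,T)$ ($k\ge0$) the non-increasing singular values of a compact operator $T$. $\mathcal{L}_{1,\infty}=\{T\text{ compact}:\mu(k,T)=O((k+1)^{-1})\}$; $[\mathcal{L}_{1,\infty},\mathcal{L}(H)]$ is the linear span of all commutators $[T,S]$, $T\in\mathcal{L}_{1,\infty}$, $S\in\mathcal{L}(H)$. ${\rm diag}(\alpha)$ is the diagonal operator, with respect to a fixed orthonormal basis of $H$, of a bounded sequence $\alpha$. A trace on $\mathcal{L}_{1,\infty}$ is a unitarily invariant linear functional $\varphi:\mathcal{L}_{1,\infty}\to\mathbb{C}$ (equivalently, a linear functional vanishing on $[\mathcal{L}_{1,\infty},\mathcal{L}(H)]$; no continuity assumed); it is normalised if $\varphi(T)=1$ whenever $0\le T$ and $\mu(k,T)=1/(k+1)$ for all $k\ge0$. *)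

(* Defs.v *)
From HB Require Import structures.
From mathcomp Require Import all_boot all_order all_algebra.
From mathcomp Require Import complex.
From mathcomp Require Import all_classical all_reals all_analysis.

Set Implicit Arguments.
Unset Strict Implicit.
Unset Printing Implicit Defensive.

Import Order.TTheory GRing.Theory Num.Theory.
Import numFieldNormedType.Exports.

Local Open Scope classical_set_scope.
Local Open Scope ring_scope.
Local Open Scope complex_scope.

HB.mixin Record isHilbert (R : realType) (H : Type)
    of CompleteNormedModule R[i] H := {
  inner : {dot H for Num.conj};
  inner_norm : forall x : H, `|x| ^+ 2 = inner x x
}.

(* Complex Hilbert spaces; the inner product is linear in its first argument. *)
#[short(type="hilbertType")]
HB.structure Definition Hilbert (R : realType) :=
  {H of CompleteNormedModule R[i] H & isHilbert R H}.

Definition linspan (K : numFieldType) (V : lmodType K) (A : set V) : set V :=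
  [set x | exists n (v : 'I_n -> V) (c : 'I_n -> K),
    (forall i, A (v i)) /\ x = \sum_i c i *: v i].

Definition linindep (K : numFieldType) (V : lmodType K) n (v : 'I_n -> V) :=
  forall c : 'I_n -> K, \sum_i c i *: v i = 0 -> forall i, c i = 0.

Definition has_dim (K : numFieldType) (V : lmodType K) (E : set V) (n : nat) :=
  exists v : 'I_n -> V, linindep v /\ E = linspan (range v).

Section Space.
Context {R : realType} (H : hilbertType R).

Definition separable := exists2 A : set H, countable A & dense A.

Definition infinite_dimensional := forall n, ~ has_dim [set: H] n.

Definition orthonormal_basis (e : nat -> H) :=
  (forall j k, inner (e j) (e k) = (j == k)%:R) /\
  closure (linspan (range e)) = [set: H].

End Space.

(* Operators are plain functions H -> H, with their pointwise linear structure. *)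
Section Operators.
Context {R : realType} {H : hilbertType R}.
Implicit Types T S U : H -> H.

Definition bounded_op : set (H -> H) :=
  [set T | linear T /\ exists M : R, forall x, `|T x| <= M%:C * `|x|].

Definition compact_op : set (H -> H) :=
  [set T | bounded_op T /\ compact (closure (T @` [set x | `|x| <= 1]))].

(* The Riesz vector of x |-> (T x, y), which exists and is unique for bounded T. *)
Definition adjoint T : H -> H :=
  fun y => get [set w | forall x, inner (T x) y = inner x w].

Definition unitary_op : set (H -> H) :=
  [set U | [/\ bounded_op U, U \o adjoint U = id & adjoint U \o U = id]].

Definition positive_op T := forall x, 0 <= inner (T x) x.

Definition eigenspace_op T (a : R[i]) : set H := [set x | T x = a *: x].

(* s lists, in non-increasing order, the square roots of the eigenvalues of
   T^* T, each t > 0 occurring as often as the multiplicity of t ^ 2; when T has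
   finite rank the list is padded with zeros. *)
Definition singular_sequence T (s : nat -> R) :=
  [/\ forall k, 0 <= s k,
      forall j k, (j <= k)%N -> s k <= s j &
      forall t : R, 0 < t -> exists2 n,
        has_dim (eigenspace_op (adjoint T \o T) ((t ^+ 2)%:C)) n &
        ([set k | s k = t] #= `I_n)%card].

(* For compact T there is exactly one singular sequence. *)
Definition mu (k : nat) T : R := get (singular_sequence T) k.

Definition weak_L1 : set (H -> H) :=
  [set T | compact_op T /\
    exists M : R, forall k, mu k T <= M * (k.+1%:R)^-1].

Definition commutator_space (I J : set (H -> H)) : set (H -> H) :=
  linspan [set (T \o S) - (S \o T) | T in I & S in J].

Definition diag (e : nat -> H) (a : nat -> R[i]) : H -> H :=
  fun x => limn (series (fun k => (a k * inner x (e k)) *: e k)).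

(* phi stands for its restriction to weak_L1; its values elsewhere are
   irrelevant. *)
Definition is_trace (phi : (H -> H) -> R[i]) :=
  (forall (a : R[i]) T S, weak_L1 T -> weak_L1 S ->
     phi (a *: T + S) = a * phi T + phi S) /\
  (forall U T, unitary_op U -> weak_L1 T ->
     phi (U \o T \o adjoint U) = phi T).

Definition normalised (phi : (H -> H) -> R[i]) :=
  forall T, weak_L1 T -> positive_op T ->
    (forall k, mu k T = (k.+1%:R)^-1) -> phi T = 1.

End Operators.

(* Main.v *)
Require Import Defs.
From mathcomp Require Import all_boot all_order all_algebra.
From mathcomp Require Import complex.
From mathcomp Require Import finmap.
From mathcomp Require Import all_classical all_reals all_analysis.
From mathcomp Require Import ring lra.

(** Write D for the diagonal operator with entries 1/(k+1), and Comm for the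
    span of the commutators. Every trace vanishes on Comm (trace_comm), and
    conversely a linear functional that vanishes on Comm is a trace
    (vanishing_is_trace), normalised as soon as it takes the value 1 at D
    (vanishing_is_normalised). If T - z D is in Comm, a normalised trace
    therefore has at T the same value as at z D, namely z. If T - z D is not in
    Comm, linear algebra (linear_separation, by Zorn) provides a functional
    vanishing on Comm and nonzero at T - z D; since D itself is not in Comm
    (harmD_not_commutators), it can be corrected to take the value 1 at D, and
    is then a normalised trace whose value at T is not z.

    Why traces vanish on commutators. Let A be self-adjoint with norm at most
    1/2, V = 1 - iA and W = 1 + iA. These commute, are invertible by a Neumann
    series and adjoint to each other, so the Cayley transform U = W V^-1 is
    unitary. For T in the ideal, U (V T W) U^* = W T V, so a trace agrees on
    V T W and W T V; their difference is 2i (T A - A T). This avoids writing a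
    bounded operator as a combination of unitaries, which would take square
    roots of positive operators. A general bounded operator is a combination of
    two self-adjoint ones.

    Why only D matters for the normalisation. A positive T with the singular
    values of D need not be unitarily equivalent to D, because it can have a
    kernel, but it is V B with B = D V^* for an isometry V (harmonic_structure).
    Since B V = D, the difference T - D = V B - B V is a commutator.

    Why D is not in Comm. If D is a combination of m commutators of T_i and S_i,
    choose for each n an orthonormal family u of O(n) vectors that starts with
    e_0, ..., e_(n-1) and on whose orthogonal complement all the T_i and their
    adjoints are O(1/n). The trace of a commutator compressed to the span of u
    only sees what leaks out of that span, hence is O(n) O(1/n) = O(1)
    (ptrace_comm), whereas for D it is at least 1 + 1/2 + ... + 1/n
    (ptrace_harmD).

    Everything rests on a description of the ideal without singular values
    (weak_L1P): T belongs to it when it is compact and, for each n, is at most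
    C/(n+1) on the orthogonal complement of some n vectors. From this the ideal
    properties are immediate. Singular values are reached through the spectral
    theorem for the compact positive operator T^* T: on the orthogonal
    complement of finitely many eigenvectors the norm of T is attained, at an
    eigenvector (top_eigenvector); iterating gives an orthonormal sequence
    (svd_exists) whose values form a singular sequence (svd_singular), and a
    singular sequence is unique (singular_uniq). *)

Import Order.TTheory GRing.Theory Num.Theory.
Import numFieldNormedType.Exports.
Set Implicit Arguments.
Unset Strict Implicit.
Unset Printing Implicit Defensive.
Local Open Scope classical_set_scope.
Local Open Scope ring_scope.
Local Open Scope complex_scope.


(** * Real-valued norms and inner products *)

Section RealNorm.
Context {R : realType}.

(** The norm of a complex normed space is a nonnegative complex number; its real
    part is the same number in the field where estimates can use a total
    order. *)
Definition nrm {V : normedModType R[i]} (x : V) : R := complex.Re `|x|.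

Section Gen.
Context {V : normedModType R[i]}.
Implicit Types x y : V.

Lemma nrmE x : `|x| = (nrm x)%:C.
Proof. by rewrite /nrm RRe_real// ger0_real. Qed.

Lemma nrm_ge0 x : 0 <= nrm x.
Proof. by rewrite -ler0c -nrmE. Qed.

Lemma nrm0 : nrm (0 : V) = 0.
Proof. by rewrite /nrm normr0. Qed.

Lemma nrm_eq0 x : (nrm x == 0) = (x == 0).
Proof. by rewrite -[RHS]normr_eq0 nrmE (inj_eq (@complexI R)). Qed.

Lemma nrmD x y : nrm (x + y) <= nrm x + nrm y.
Proof. by rewrite -lecR rmorphD/= -!nrmE ler_normD. Qed.

Lemma nrmN x : nrm (- x) = nrm x.
Proof. by rewrite /nrm normrN. Qed.

Lemma nrmB x y : nrm (x - y) = nrm (y - x).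
Proof. by rewrite -opprB nrmN. Qed.

Lemma nrm_sum (I : Type) (r : seq I) (P : pred I) (F : I -> V) :
  nrm (\sum_(i <- r | P i) F i) <= \sum_(i <- r | P i) nrm (F i).
Proof.
elim/big_ind2 : _ => [|x1 x2 y1 y2 h1 h2|//]; first by rewrite nrm0.
exact: le_trans (nrmD _ _) (lerD h1 h2).
Qed.

Lemma nrmZ (a : R[i]) x : nrm (a *: x) = nrm (a : R[i]^o) * nrm x.
Proof. by apply: (@complexI R); rewrite rmorphM/= -!nrmE normrZ. Qed.

Lemma nrm_cvg {I : Type} {F : set_system I} {FF : Filter F} (u : I -> V) (l : V) :
  u @ F --> l <-> forall eps : R, 0 < eps -> \forall i \near F, nrm (l - u i) < eps.
Proof.
split=> [/cvgrPdist_lt h eps e0|h].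
  have := h eps%:C; rewrite ltcR => /(_ e0); apply: filterS => i.
  by rewrite nrmE ltcR.
apply/cvgrPdist_lt => -[a b]; rewrite ltcE/= => /andP[/eqP-> a0].
by apply: filterS (h a a0) => i; rewrite nrmE ltcR.
Qed.

(** Closeness measured by the real norm: this is what reduces density arguments
    to estimates. *)
Lemma nrm_closure (A : set V) x : closure A x <->
  forall eps : R, 0 < eps -> exists2 a, A a & nrm (x - a) < eps.
Proof.
split=> [h eps e0|h].
  have [|a [Aa]] := h (ball x eps%:C); first by apply: nbhsx_ballx; rewrite ltcR.
  by rewrite -ball_normE/= nrmE ltcR; exists a.
move=> B /nbhs_ballP[[a b]/=]; rewrite ltcE/= => /andP[/eqP-> a0] aB.
have [y Ay ya] := h a a0; exists y; split=> //; apply: aB.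
by rewrite -ball_normE/= nrmE ltcR.
Qed.

Lemma nrm_small x : (forall eps : R, 0 < eps -> nrm x <= eps) -> x = 0.
Proof.
move=> h; apply/eqP; rewrite -nrm_eq0 eq_le nrm_ge0 andbT.
rewrite leNgt; apply/negP => x0; have /h : 0 < nrm x / 2 by rewrite divr_gt0.
by apply/negP; rewrite -ltNge; lra.
Qed.

End Gen.

Lemma nrm_cauchy {V : completeNormedModType R[i]} {F : set_system V}
    {FF : ProperFilter F} :
  (forall eps : R, 0 < eps -> exists x, \forall y \near F, nrm (x - y) < eps) ->
  cvg F.
Proof.
move=> h; apply/cauchy_cvgP/cauchy_exP => -[a b]/=.
rewrite ltcE/= => /andP[/eqP-> a0]; have [x Hx] := h a a0; exists x.
by apply: filterS Hx => y; rewrite -ball_normE/= nrmE ltcR.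
Qed.

Notation cmod := (nrm : R[i]^o -> R).

Lemma cmodM (a b : R[i]) : cmod (a * b) = cmod a * cmod b.
Proof. exact: (@nrmZ R[i]^o a b). Qed.

Lemma cmod_conj (a : R[i]) : cmod (Num.conj a) = cmod a.
Proof. by rewrite /nrm norm_conjC. Qed.

Lemma cmodR (a : R) : cmod a%:C = `|a|.
Proof. by rewrite /nrm normc_def/= expr0n addr0 sqrtr_sqr. Qed.

Lemma cmod_id (a : R) : 0 <= a -> cmod a%:C = a.
Proof. by move=> a0; rewrite cmodR ger0_norm. Qed.

Lemma conjR (r : R) : Num.conj (r%:C : R[i]) = r%:C.
Proof. exact: conjc_real. Qed.

Lemma cmod_sqr (a : R[i]) : ((cmod a) ^+ 2)%:C = a * Num.conj a.
Proof. by rewrite rmorphXn/= -nrmE -normCK. Qed.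

End RealNorm.
Notation cmod := (nrm : _[i]^o -> _).

Section Inner.
Context {R : realType} {H : hilbertType R}.
Implicit Types x y z : H.

Lemma innerDl x y z : inner (x + y) z = inner x z + inner y z.
Proof. exact: linearDl. Qed.
Lemma innerDr x y z : inner z (x + y) = inner z x + inner z y.
Proof. exact: linearDr. Qed.
Lemma innerZl a x y : inner (a *: x) y = a * inner x y.
Proof. exact: linearZl_LR. Qed.
Lemma innerZr a x y : inner x (a *: y) = Num.conj a * inner x y.
Proof. exact: linearZr_LR. Qed.
Lemma innerC x y : inner y x = Num.conj (inner x y).
Proof. by rewrite (@hermC _ _ Num.conj) expr0 mul1r. Qed.
Lemma inner0l x : inner 0 x = 0.
Proof. exact: linear0l. Qed.
Lemma inner0r x : inner x 0 = 0.
Proof. exact: linear0r. Qed.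
Lemma innerNl x y : inner (- x) y = - inner x y.
Proof. exact: linearNl. Qed.
Lemma innerNr x y : inner x (- y) = - inner x y.
Proof. exact: linearNr. Qed.
Lemma innerBl x y z : inner (x - y) z = inner x z - inner y z.
Proof. exact: linearBl. Qed.
Lemma innerBr x y z : inner z (x - y) = inner z x - inner z y.
Proof. exact: linearBr. Qed.
Lemma inner_suml (I : Type) (r : seq I) (P : pred I) (F : I -> H) x :
  inner (\sum_(i <- r | P i) F i) x = \sum_(i <- r | P i) inner (F i) x.
Proof. exact: linear_sumlz. Qed.
Lemma inner_sumr (I : Type) (r : seq I) (P : pred I) (F : I -> H) x :
  inner x (\sum_(i <- r | P i) F i) = \sum_(i <- r | P i) inner x (F i).
Proof. exact: linear_sumr. Qed.

Lemma innerxx x : inner x x = (nrm x ^+ 2)%:C.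
Proof. by rewrite -inner_norm nrmE rmorphXn. Qed.

Lemma innerxx0 x : inner x x = 0 -> x = 0.
Proof.
rewrite innerxx => /complexI/eqP; rewrite expf_eq0/= nrm_eq0.
by move=> /eqP.
Qed.

Lemma inner_inj x y : (forall z, inner z x = inner z y) -> x = y.
Proof.
move=> h; apply/eqP; rewrite -subr_eq0; apply/eqP/innerxx0.
by rewrite innerBr h subrr.
Qed.

Lemma inner_injl x y : (forall z, inner x z = inner y z) -> x = y.
Proof. by move=> h; apply: inner_inj => z; rewrite innerC h -innerC. Qed.

Lemma pythagoras x y : inner x y = 0 -> nrm (x + y) ^+ 2 = nrm x ^+ 2 + nrm y ^+ 2.
Proof.
move=> xy; apply: (@complexI R); rewrite rmorphD/= -!innerxx.
by rewrite innerDl !innerDr xy (innerC x y) xy rmorph0 addr0 add0r.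
Qed.

(** Pythagoras for x = (x - a y) + a y, where a y is the projection of x on the
    line through y. *)
Lemma cauchy_schwarz x y : cmod (inner x y) <= nrm x * nrm y.
Proof.
have [->|y0] := eqVneq y 0; first by rewrite inner0r !nrm0 mulr0.
have ny : 0 < nrm y by rewrite lt_def nrm_ge0 nrm_eq0 y0.
have ny2 : inner y y != 0 by apply/eqP => /innerxx0/eqP; apply/negP.
pose a := inner x y / inner y y.
have o : inner (x - a *: y) (a *: y) = 0.
  by rewrite innerZr innerBl innerZl divfK// subrr mulr0.
have := pythagoras o; rewrite subrK nrmZ => E.
have {E} h : cmod a * nrm y <= nrm x.
  by rewrite -(@ler_pXn2r _ 2)// ?nnegrE ?mulr_ge0 ?nrm_ge0// E lerDr sqr_ge0.
have -> : inner x y = a * inner y y by rewrite divfK.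
rewrite cmodM innerxx cmod_id ?sqr_ge0// expr2 mulrA.
by rewrite ler_wpM2r// nrm_ge0.
Qed.

End Inner.

(** * Orthonormal families *)

Section Linear.
Context {K : pzRingType} {U V : lmodType K} (f : U -> V) (fl : linear f).

Lemma linD x y : f (x + y) = f x + f y.
Proof. by have := fl 1 x y; rewrite !scale1r. Qed.
Lemma lin0 : f 0 = 0.
Proof. by apply: (@addrI _ (f 0)); rewrite -linD !addr0. Qed.
Lemma linZ a x : f (a *: x) = a *: f x.
Proof. by have := fl a x 0; rewrite lin0 !addr0. Qed.
Lemma linN x : f (- x) = - f x.
Proof. by rewrite -scaleN1r linZ scaleN1r. Qed.
Lemma linB x y : f (x - y) = f x - f y.
Proof. by rewrite linD linN. Qed.
Lemma lin_sum (I : Type) (r : seq I) (P : pred I) (F : I -> U) :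
  f (\sum_(i <- r | P i) F i) = \sum_(i <- r | P i) f (F i).
Proof.
apply: (big_morph f) => [x y|]; [exact: linD|exact: lin0].
Qed.

End Linear.

Section Ortho.
Context {R : realType} {H : hilbertType R}.
Implicit Types x y z : H.

Definition orthonormal_family {I : eqType} (v : I -> H) :=
  forall i j, inner (v i) (v j) = (i == j)%:R.

Lemma orthonormal_nrm (I : eqType) (v : I -> H) i :
  orthonormal_family v -> nrm (v i) = 1.
Proof.
move=> ov; have := ov i i; rewrite eqxx innerxx => /(@complexI R)/eqP.
by rewrite sqrp_eq1 ?nrm_ge0// => /eqP.
Qed.

Lemma orthonormal_inner_sum (I : eqType) (v : I -> H) (r : seq I) (c : I -> R[i]) j :
  orthonormal_family v -> uniq r ->
  inner (\sum_(i <- r) c i *: v i) (v j) = if j \in r then c j else 0.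
Proof.
move=> ov; elim: r => [|i r IH]/=; first by rewrite big_nil inner0l.
move=> /andP[ir ur]; rewrite big_cons innerDl IH// innerZl ov in_cons eq_sym.
have [->|] := eqVneq j i; last by rewrite mulr0 add0r.
by rewrite (negbTE ir) mulr1 addr0.
Qed.

Lemma orthonormal_nrm_sum (I : eqType) (v : I -> H) (r : seq I) (c : I -> R[i]) :
  orthonormal_family v -> uniq r ->
  nrm (\sum_(i <- r) c i *: v i) ^+ 2 = \sum_(i <- r) cmod (c i) ^+ 2.
Proof.
move=> ov ur; apply: (@complexI R); rewrite -innerxx inner_sumr rmorph_sum/=.
rewrite !big_seq; apply: eq_bigr => j jr.
by rewrite innerZr -big_seq orthonormal_inner_sum// jr mulrC -cmod_sqr.
Qed.

(** The difference between x and its Fourier sum is orthogonal to the family. *)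
Lemma bessel_split (I : eqType) (v : I -> H) (r : seq I) x :
  orthonormal_family v -> uniq r ->
  nrm x ^+ 2 = nrm (x - \sum_(i <- r) inner x (v i) *: v i) ^+ 2
               + \sum_(i <- r) cmod (inner x (v i)) ^+ 2.
Proof.
move=> ov ur; rewrite -(orthonormal_nrm_sum _ ov ur) -pythagoras ?subrK//.
rewrite inner_sumr big_seq big1// => j jr.
by rewrite innerZr innerBl orthonormal_inner_sum// jr subrr mulr0.
Qed.

Lemma bessel (I : eqType) (v : I -> H) (r : seq I) x : orthonormal_family v -> uniq r ->
  \sum_(i <- r) cmod (inner x (v i)) ^+ 2 <= nrm x ^+ 2.
Proof. by move=> ov ur; rewrite (bessel_split x ov ur) lerDr sqr_ge0. Qed.

Section Limits.
Context {I : Type} {F : set_system I} {FF : ProperFilter F}.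

(** Stated for eventually constant inner products: every use identifies a limit
    vector by its coordinates. *)
Lemma inner_lim (u : I -> H) l y c : u @ F --> l ->
  (\forall i \near F, inner (u i) y = c) -> inner l y = c.
Proof.
move=> /nrm_cvg ul uc; apply/eqP; rewrite -subr_eq0; apply/eqP.
apply: (@nrm_small _ R[i]^o) => e e0.
have y1 : 0 < nrm y + 1 by rewrite ltr_wpDl ?nrm_ge0.
have [i [ui <-]] := filter_ex (filterI (ul _ (divr_gt0 e0 y1)) uc).
rewrite -innerBl (le_trans (cauchy_schwarz _ _))//.
rewrite (@le_trans _ _ (e / (nrm y + 1) * (nrm y + 1)))//; last first.
  by rewrite divfK// gt_eqF.
by rewrite ler_pM ?nrm_ge0 ?ltW// ltrDl.
Qed.

Lemma nrm_lim_le {V : normedModType R[i]} (u : I -> V) l (B : R) : u @ F --> l ->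
  (\forall i \near F, nrm (u i) <= B) -> nrm l <= B.
Proof.
move=> /nrm_cvg ul uB; rewrite leNgt; apply/negP => Bl.
have d0 : 0 < nrm l - B by rewrite subr_gt0.
have [i [ui uiB]] := filter_ex (filterI (ul _ d0) uB).
have := nrmD (l - u i) (u i); rewrite subrK => h.
lra.
Qed.

Lemma nrm_lim_ge {V : normedModType R[i]} (u : I -> V) l (B : R) : u @ F --> l ->
  (\forall i \near F, B <= nrm (u i)) -> B <= nrm l.
Proof.
move=> /nrm_cvg ul uB; rewrite leNgt; apply/negP => Bl.
have d0 : 0 < B - nrm l by rewrite subr_gt0.
have [i [ui uiB]] := filter_ex (filterI (ul _ d0) uB).
have := nrmD (u i - l) l; rewrite subrK nrmB => h.
lra.
Qed.

Lemma bounded_cvg {V W : normedModType R[i]} (f : V -> W) (M : R) (u : I -> V) l :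
  linear f -> (forall x : V, nrm (f x) <= M * nrm x) ->
  u @ F --> l -> (f \o u) @ F --> f l.
Proof.
move=> fl fM /nrm_cvg ul; apply/nrm_cvg => e e0.
have y1 : 0 < `|M| + 1 by rewrite ltr_wpDl.
apply: filterS (ul _ (divr_gt0 e0 y1)) => i.
rewrite ltr_pdivlMr// => h; rewrite -linB// (le_lt_trans (fM _))//.
apply: le_lt_trans h; rewrite mulrC ler_wpM2l ?nrm_ge0//.
by rewrite (le_trans (ler_norm _))// lerDl.
Qed.

End Limits.

(** By Pythagoras, distances between partial sums are differences of partial sums
    of the squared coefficients, an increasing bounded sequence. *)
Lemma orthonormal_cvg (v : nat -> H) (c : nat -> R[i]) (B : R) : orthonormal_family v ->
  (forall n, \sum_(0 <= k < n) cmod (c k) ^+ 2 <= B) ->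
  exists l, [/\ series (fun k => c k *: v k) @ \oo --> l,
    forall k, inner l (v k) = c k & nrm l ^+ 2 <= B].
Proof.
move=> ov cB; set u := series _.
pose s n := \sum_(0 <= k < n) cmod (c k) ^+ 2.
have uE n m : (n <= m)%N -> nrm (u m - u n) ^+ 2 = s m - s n.
  move=> nm; rewrite /u sub_series_geq// orthonormal_nrm_sum ?iota_uniq//.
  by rewrite /s (@big_cat_nat _ _ _ n 0 m)//= addrC addrK.
have sinc : {homo s : n m / (n <= m)%N >-> n <= m}.
  by move=> n m nm; rewrite -subr_ge0 -uE// sqr_ge0.
have sbnd : has_ubound (range s) by exists B => _ [n _ <-]; exact: cB.
have scvg := nondecreasing_cvgn sinc sbnd.
have sle n : s n <= sup (range s) by apply: ub_le_sup => //; exists n.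
have ucvg : cvgn u.
  apply: nrm_cauchy => e e0.
  have [N _ HN] := @cvgr_dist_lt _ _ _ _ _ _ _ scvg (e ^+ 2) (exprn_gt0 _ e0).
  exists (u N); exists N => // n/= Nn.
  rewrite nrmB -(@ltr_pXn2r _ 2)// ?nnegrE ?nrm_ge0 ?ltW// uE//.
  have := HN N (leqnn _); rewrite /= ger0_norm ?subr_ge0//.
  by have := sle n; lra.
exists (limn u); split=> //.
- move=> k; apply: (inner_lim ucvg); exists k.+1 => // n/= kn.
  by rewrite /u /series/= orthonormal_inner_sum ?iota_uniq// mem_index_iota kn.
- have B0 : 0 <= B by have := cB 0%N; rewrite big_geq.
  rewrite -[leRHS]sqr_sqrtr// ler_pXn2r ?nnegrE ?nrm_ge0 ?sqrtr_ge0//.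
  apply: (nrm_lim_le ucvg); apply: nearW => n.
  rewrite -(@ler_pXn2r _ 2)// ?nnegrE ?nrm_ge0 ?sqrtr_ge0// sqr_sqrtr//.
  by rewrite /u /series/= orthonormal_nrm_sum ?iota_uniq.
Qed.

End Ortho.

(** * Bounded operators, adjoints and orthonormal bases *)

Section Bounded.
Context {R : realType} {H : hilbertType R}.
Implicit Types (x y z : H) (T S : H -> H).

Lemma bounded_opP T : bounded_op T <->
  linear T /\ exists2 M : R, 0 <= M & forall x, nrm (T x) <= M * nrm x.
Proof.
split=> -[Tl].
  move=> [M TM]; split=> //; exists `|M| => // x.
  have := TM x; rewrite !nrmE -rmorphM/= lecR => h; apply: le_trans h _.
  by rewrite ler_wpM2r ?nrm_ge0// ler_norm.
move=> [M M0 TM]; split=> //; exists M => x.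
by rewrite !nrmE -rmorphM/= lecR.
Qed.

Lemma bounded_op_linear T : bounded_op T -> linear T. Proof. by case. Qed.

Lemma bounded_op_id : bounded_op (@idfun H).
Proof. by apply/bounded_opP; split=> //; exists 1 => // x; rewrite mul1r. Qed.

Lemma bounded_op_comp T S : bounded_op T -> bounded_op S -> bounded_op (T \o S).
Proof.
move=> /bounded_opP[Tl [M M0 TM]] /bounded_opP[Sl [N N0 SN]]; apply/bounded_opP; split.
  by move=> a x y; rewrite /= Sl Tl.
exists (M * N); first exact: mulr_ge0.
by move=> x; rewrite -mulrA (le_trans (TM _))// ler_wpM2l.
Qed.

Lemma bounded_op_addZ a T S : bounded_op T -> bounded_op S -> bounded_op (a *: T + S).
Proof.
move=> /bounded_opP[Tl [M M0 TM]] /bounded_opP[Sl [N N0 SN]]; apply/bounded_opP; split.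
  move=> b x y; rewrite !fctE Sl Tl !scalerDr !scalerA [a * b]mulrC.
  by rewrite [LHS]addrACA.
exists (cmod a * M + N).
  by rewrite addr_ge0// mulr_ge0// nrm_ge0.
move=> x; rewrite !fctE (le_trans (nrmD _ _))// mulrDl lerD//.
by rewrite nrmZ -mulrA ler_wpM2l// nrm_ge0.
Qed.

Lemma bounded_op_cvg {I : Type} {F : set_system I} {FF : ProperFilter F} T u l :
  bounded_op T -> u @ F --> l -> (T \o u) @ F --> T l.
Proof. by move=> /bounded_opP[Tl [M M0 TM]]; apply: bounded_cvg TM. Qed.

End Bounded.

Section Basis.
Context {R : realType} {H : hilbertType R} {e : nat -> H}.
Hypothesis eP : orthonormal_basis e.
Implicit Types (x y z : H) (T S : H -> H).

Lemma basis_orthonormal : orthonormal_family e. Proof. by case: eP. Qed.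

(** A bounded linear map that kills the basis kills its span, hence, by
    boundedness, the closure of the span. *)
Lemma basis_total {V : normedModType R[i]} (f : H -> V) (M : R) :
  linear f -> (forall x, nrm (f x) <= M * nrm x) ->
  (forall k, f (e k) = 0) -> forall x, f x = 0.
Proof.
move=> fl fM fe x; have : closure (linspan (range e)) x by case: eP => _ ->.
move=> /nrm_closure xe; apply: nrm_small => eps e0.
have y1 : 0 < `|M| + 1 by rewrite ltr_wpDl.
have [_ [n [v [c [ve ->]]]] h] := xe _ (divr_gt0 e0 y1).
have := fM (x - \sum_i c i *: v i).
rewrite linB// lin_sum// big1 ?subr0; last first.
  by move=> i _; rewrite linZ//; have [k _ <-] := ve i; rewrite fe scaler0.
move=> /le_trans; apply; move: h; rewrite ltr_pdivlMr// => /ltW; apply: le_trans.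
rewrite mulrC ler_wpM2l ?nrm_ge0// (le_trans (ler_norm _))// lerDl//.
Qed.

Lemma basis_eq0 x : (forall k, inner (e k) x = 0) -> x = 0.
Proof.
move=> h; apply: innerxx0.
apply: (@basis_total R[i]^o (inner^~ x) (nrm x)) => //.
  by move=> a y z; rewrite /= innerDl innerZl.
by move=> y; rewrite mulrC cauchy_schwarz.
Qed.

Lemma bounded_op_ext T S : bounded_op T -> bounded_op S ->
  (forall k, T (e k) = S (e k)) -> T = S.
Proof.
move=> bT bS h; apply/funext => x; apply/eqP; rewrite -subr_eq0; apply/eqP.
have /bounded_opP[ll [M M0 lM]] := bounded_op_addZ (-1) bS bT.
have -> : T x - S x = (-1 *: S + T) x by rewrite !fctE scaleN1r addrC.
by apply: (basis_total ll lM) => k; rewrite !fctE h scaleN1r addNr.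
Qed.

(** The candidate has coordinates the conjugates of f (e k). They are square
    summable: for the partial sum x_n, f x_n is the sum s of their squares
    while the norm of x_n is the square root of s, so boundedness of f gives
    s <= M sqrt s. *)
Lemma riesz (f : H -> R[i]^o) (M : R) : 0 <= M -> linear f ->
  (forall x, cmod (f x) <= M * nrm x) -> exists w, forall x, f x = inner x w.
Proof.
move=> M0 fl fM; pose c k := Num.conj (f (e k)).
have cE k : cmod (c k) = cmod (f (e k)) by rewrite cmod_conj.
have [n|w [_ wc _]] := @orthonormal_cvg _ _ e c (M ^+ 2) basis_orthonormal.
  set s := \sum_(_ <= _ < _) _.
  have s0 : 0 <= s by apply: sumr_ge0 => ? _; rewrite sqr_ge0.
  have := fM (\sum_(0 <= k < n) c k *: e k).
  rewrite lin_sum//.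
  have -> : \sum_(0 <= i < n) f (c i *: e i) = s%:C.
    rewrite rmorph_sum/=; apply: eq_bigr => i _.
    by rewrite linZ// cE cmod_sqr mulrC.
  rewrite cmod_id// -(@ler_pXn2r _ 2)// ?nnegrE ?mulr_ge0 ?nrm_ge0//.
  rewrite exprMn orthonormal_nrm_sum ?iota_uniq//; last exact: basis_orthonormal.
  rewrite -/s expr2; have [->|sn0] := eqVneq s 0; first by rewrite sqr_ge0.
  by rewrite ler_pM2r// lt_def sn0.
exists w => x; apply/eqP; rewrite -subr_eq0; apply/eqP.
apply: (@basis_total R[i]^o (fun x => f x - inner x w) (M + nrm w)) => //.
- move=> a y z; rewrite fl innerDl innerZl opprD.
  by rewrite addrACA scalerBr.
- move=> y; rewrite (le_trans (nrmD _ _))// nrmN mulrDl lerD//.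
  by rewrite mulrC cauchy_schwarz.
- by move=> k; rewrite innerC wc /c conjCK subrr.
Qed.

Lemma adjointE T : bounded_op T -> forall x y, inner (T x) y = inner x (adjoint T y).
Proof.
move=> /bounded_opP[Tl [M M0 TM]] x y.
have [|||y0 h] := @riesz (fun x => inner (T x) y) (M * nrm y).
- by rewrite mulr_ge0 ?nrm_ge0.
- by move=> a u v; rewrite Tl innerDl innerZl.
- move=> u; rewrite (le_trans (cauchy_schwarz _ _))// mulrAC.
  by rewrite ler_wpM2r ?nrm_ge0.
have : exists w, forall x, inner (T x) y = inner x w by exists y0.
by move=> /getPex; apply.
Qed.

Lemma adjointEr T : bounded_op T -> forall x y, inner (adjoint T x) y = inner x (T y).
Proof. by move=> bT x y; rewrite innerC -adjointE// -innerC. Qed.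

Lemma adjoint_uniq T S : (forall x y, inner (T x) y = inner x (S y)) -> adjoint T = S.
Proof.
move=> h; apply/funext => y.
have : exists w, forall x, inner (T x) y = inner x w by exists (S y).
move=> /getPex hw; apply: inner_inj => z; rewrite -h.
by rewrite -hw.
Qed.

Lemma adjoint_bounded T : bounded_op T -> bounded_op (adjoint T).
Proof.
move=> bT; have /bounded_opP[Tl [M M0 TM]] := bT; apply/bounded_opP; split.
  move=> a x y; apply: inner_inj => z.
  by rewrite -adjointE// innerDr [RHS]innerDr !innerZr -!adjointE.
exists M => // x; have [->|x0] := eqVneq (adjoint T x) 0.
  by rewrite nrm0 mulr_ge0 ?nrm_ge0.
rewrite -(@ler_pM2r _ (nrm (adjoint T x))) ?lt_def ?nrm_eq0 ?x0 ?nrm_ge0//.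
rewrite -expr2 -[leLHS]cmod_id ?sqr_ge0// -innerxx adjointEr//.
by rewrite (le_trans (cauchy_schwarz _ _))// mulrAC mulrC ler_wpM2r ?nrm_ge0.
Qed.

(** The operator that sends e k to a k *: v k. With v = e it is diag e a, and
    with a = 1 and v orthonormal it is an isometry. *)
Definition gdiag (v : nat -> H) (a : nat -> R[i]) : H -> H :=
  fun x => limn (series (fun k => (a k * inner x (e k)) *: v k)).

Section Gdiag.
Variables (v : nat -> H) (a : nat -> R[i]) (M : R).
Hypotheses (ov : orthonormal_family v) (aM : forall k, cmod (a k) <= M).

Let M0 : 0 <= M. Proof. exact: le_trans (nrm_ge0 _) (aM 0%N). Qed.

Lemma gdiag_spec x : [/\
  series (fun k => (a k * inner x (e k)) *: v k) @ \oo --> gdiag v a x,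
  forall k, inner (gdiag v a x) (v k) = a k * inner x (e k) &
  nrm (gdiag v a x) <= M * nrm x].
Proof.
have [n|l [ul lk lM]] := @orthonormal_cvg _ _ v (fun k => a k * inner x (e k))
    ((M * nrm x) ^+ 2) ov.
  apply: (@le_trans _ _ (\sum_(0 <= k < n) M ^+ 2 * cmod (inner x (e k)) ^+ 2)).
    apply: ler_sum => k _; rewrite cmodM exprMn ler_wpM2r ?sqr_ge0//.
    by rewrite ler_pXn2r ?nnegrE ?nrm_ge0.
  rewrite -mulr_sumr exprMn ler_wpM2l ?sqr_ge0// bessel ?iota_uniq//.
  exact: basis_orthonormal.
have -> : gdiag v a x = l by apply/cvg_lim.
split=> //; move: lM; rewrite ler_pXn2r// ?nnegrE ?mulr_ge0 ?nrm_ge0//.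
Qed.

Lemma gdiag_bounded : bounded_op (gdiag v a).
Proof.
apply/bounded_opP; split; last first.
  by exists M => // x; have [] := gdiag_spec x.
move=> b x y; have [hx _ _] := gdiag_spec x; have [hy _ _] := gdiag_spec y.
rewrite [LHS]/gdiag; apply: cvg_lim => //; have h := cvgD (cvgZl_tmp (k := b) hx) hy.
suff -> : series (fun k => (a k * inner (b *: x + y) (e k)) *: v k) =
  (b \*: series (fun k => (a k * inner x (e k)) *: v k)) +
  series (fun k => (a k * inner y (e k)) *: v k) by exact: h.
apply/funext => n; rewrite !fctE.
rewrite /series/= scaler_sumr -big_split/=; apply: eq_bigr => k _.
by rewrite innerDl innerZl scalerA -scalerDl; congr (_ *: _); ring.
Qed.

Lemma gdiag_basis j : gdiag v a (e j) = a j *: v j.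
Proof.
rewrite /gdiag; apply: cvg_lim => //; apply: cvg_near_cst; exists j.+1 => // n/= jn.
rewrite /series/= (bigD1_seq j) ?iota_uniq ?mem_index_iota//=.
rewrite basis_orthonormal eqxx mulr1 big1 ?addr0// => i ij.
by rewrite basis_orthonormal eq_sym (negbTE ij) mulr0 scale0r.
Qed.

End Gdiag.
End Basis.
Arguments gdiag {R H} e v a x.

(** * Finite-dimensional linear algebra *)

Section LinAlg.
Context {K : numFieldType} {V : lmodType K}.

Lemma linspan_range n (w : 'I_n -> V) x :
  linspan (range w) x <-> exists c : 'I_n -> K, x = \sum_i c i *: w i.
Proof.
split=> [[m [u [c [uw ->]]]]|[c ->]]; last first.
  by exists n, w, c; split=> // i; exists i.
have /choice[j jw] : forall k, exists i, w i = u k.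
  by move=> k; have [i _ <-] := uw k; exists i.
exists (fun i => \sum_(k | j k == i) c k).
rewrite (partition_big j xpredT)//=; apply: eq_bigr => i _.
by rewrite scaler_suml; apply: eq_bigr => k /eqP <-; rewrite jw.
Qed.

Lemma left_kernel m n (A : 'I_m -> 'I_n -> K) : (n < m)%N ->
  exists2 c : 'I_m -> K, (exists i, c i != 0) & forall j, \sum_i c i * A i j = 0.
Proof.
move=> nm; pose M := \matrix_(i, j) A i j.
have : kermx M != 0.
  rewrite -mxrank_eq0 mxrank_ker -lt0n subn_gt0.
  by rewrite (leq_ltn_trans _ nm)// rank_leq_col.
move=> /rowV0Pn[c /sub_kermxP cM c0]; exists (c 0) => [|j].
  by apply/rV0Pn; exact: c0.
have := congr1 (fun N : 'rV_n => N 0 j) cM; rewrite /= !mxE => h.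
rewrite -[RHS]h.
by apply: eq_bigr => i _; rewrite mxE.
Qed.

Lemma linindep_leq m n (v : 'I_m -> V) (w : 'I_n -> V) : linindep v ->
  (forall i, linspan (range w) (v i)) -> (m <= n)%N.
Proof.
move=> vi vw; rewrite leqNgt; apply/negP => nm.
have /choice[A Av] : forall i, exists c : 'I_n -> K, v i = \sum_j c j *: w j.
  by move=> i; apply/linspan_range.
have [c [i ci] cA] := left_kernel A nm.
have /vi/(_ i)/eqP : \sum_i c i *: v i = 0; last by rewrite (negbTE ci).
under eq_bigr => k _ do rewrite Av scaler_sumr.
rewrite exchange_big/= big1// => j _.
under eq_bigr => k _ do rewrite scalerA.
by rewrite -scaler_suml cA scale0r.
Qed.

(** Needed because a singular sequence is defined by the dimensions of
    eigenspaces. *)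
Lemma has_dim_uniq (E : set V) m n : has_dim E m -> has_dim E n -> m = n.
Proof.
move=> [v [vi Ev]] [w [wi Ew]]; apply/eqP; rewrite eqn_leq.
have inr p (u : 'I_p -> V) i : linspan (range u) (u i).
  apply/linspan_range; exists (fun j => (i == j)%:R).
  rewrite (bigD1 i)//= eqxx scale1r big1 ?addr0// => j ij.
  by rewrite eq_sym (negbTE ij) scale0r.
apply/andP; split; [apply: (linindep_leq vi (w := w))|
  apply: (linindep_leq wi (w := v))] => i; rewrite -?Ew -?Ev ?Ev//.
by rewrite -Ev Ew.
Qed.

End LinAlg.

(** * Compact sets and compact operators *)

Section Topo.

Lemma ultra_fmap (T U : Type) (f : T -> U) (F : set_system T) :
  UltraFilter F -> UltraFilter (f @ F).
Proof.
move=> FU; split; first exact: fmap_proper_filter.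
move=> G GP FG; apply/seteqP; split=> // P GP'.
have [//|nP] := in_ultra_setVsetC (f @^-1` P) FU.
have : G (P `&` ~` P) by apply: filterI => //; exact: FG.
by rewrite setICr => /filter_ex[].
Qed.

Context {R : realType} {H : hilbertType R}.
Implicit Types (x y z : H) (T S : H -> H).

Lemma hilbert_hausdorff : hausdorff_space H.
Proof. exact: norm_hausdorff. Qed.

(** Limits along ultrafilters take the place of convergent subsequences. *)
Lemma ultra_compact_cvg {I : Type} (F : set_system I) (u : I -> H) (K : set H) :
  compact K -> UltraFilter F -> (\forall i \near F, K (u i)) ->
  exists2 l, K l & u @ F --> l.
Proof.
rewrite compact_ultra => Kc FU Ku; have uFU := ultra_fmap u FU.
by have [//|l [Kl ul]] := Kc _ uFU; exists l.
Qed.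

(** Along an ultrafilter, points of A are eps-close to points of K, which
    converge; so the ultrafilter is Cauchy. *)
Lemma precompact_approx (A : set H) :
  (forall eps : R, 0 < eps -> exists2 K : set H, compact K &
     forall x, A x -> exists2 k, K k & nrm (x - k) < eps) ->
  compact (closure A).
Proof.
move=> AK; rewrite compact_ultra => F FU FA.
have [l Fl] : exists l : H, F --> l; last first.
  exists l; split=> //.
  by apply: (@closed_cvg _ _ F _ idfun (closure A)) => //; exact: closed_closure.
suff : cvg F by move=> h; exists (lim F).
apply: (@nrm_cauchy R H F) => e e0; have e3 : 0 < e / 3 by rewrite divr_gt0.
have [K Kc AeK] := AK _ e3.
have /choice[r rP] : forall y, exists k, closure A y -> K k /\ nrm (y - k) < e / 3 * 2.
  move=> y; have [Ay|nAy] := pselect (closure A y); last by exists 0.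
  have /nrm_closure/(_ _ e3)[a Aa ya] := Ay; have [k Kk ak] := AeK _ Aa.
  exists k => _; split=> //; have := nrmD (y - a) (a - k).
  by rewrite addrA subrK; lra.
have [|l Kl /nrm_cvg rl] := ultra_compact_cvg (u := r) Kc FU.
  by apply: filterS FA => y Ay; have [] := rP _ Ay.
exists l; near=> y; have : nrm (y - r y) < e / 3 * 2.
  by have /rP[] : closure A y by near: y.
have : nrm (l - r y) < e / 3 by near: y; exact: rl.
by have := nrmD (l - r y) (r y - y); rewrite addrA subrK (nrmB (r y)); lra.
Unshelve. all: by end_near. Qed.

End Topo.

Section CompactOps.
Context {R : realType} {H : hilbertType R}.
Implicit Types (x y z : H) (T S : H -> H).

Lemma bounded_op_continuous T : bounded_op T -> continuous T.
Proof. by move=> bT x; apply: (bounded_op_cvg (F := nbhs x) (u := id) bT). Qed.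

Lemma bounded_op_scale (a : R[i]) : bounded_op (fun x : H => a *: x).
Proof.
apply/bounded_opP; split; last first.
  by exists (cmod a) => [|x]; [exact: nrm_ge0|rewrite nrmZ].
by move=> b x y; rewrite scalerDr !scalerA mulrC.
Qed.

Lemma compact_image T (K : set H) : bounded_op T -> compact K -> compact (T @` K).
Proof.
move=> bT; apply: continuous_compact.
exact/continuous_subspaceT/bounded_op_continuous.
Qed.

Lemma compact_opP T : compact_op T <->
  bounded_op T /\ exists2 K : set H, compact K & forall x, nrm x <= 1 -> K (T x).
Proof.
have ball1 x : `|x| <= 1 <-> nrm x <= 1.
  by rewrite nrmE -(lecR (nrm x) 1).
split=> -[bT].
  move=> Kc; split=> //; eexists; first exact: Kc.
  by move=> x /ball1 x1; apply: subset_closure; exists x.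
move=> [K Kc KT]; split=> //.
apply: (subclosed_compact _ Kc); first exact: closed_closure.
have /closure_id -> : closed K by apply: compact_closed => //; exact: hilbert_hausdorff.
by apply: closureS => _ [x /= /ball1 x1 <-]; exact: KT.
Qed.

Lemma compact_op_bounded T : compact_op T -> bounded_op T. Proof. by case. Qed.

Lemma compact_op_ball T (r : R) : compact_op T ->
  exists2 K : set H, compact K & forall x, nrm x <= r -> K (T x).
Proof.
move=> /compact_opP[bT [K Kc KT]].
pose a := `|r| + 1; have a0 : 0 < a by rewrite ltr_wpDl.
exists ((fun x => a%:C *: x) @` K).
  by apply: compact_image Kc; exact: bounded_op_scale.
move=> x xr; exists (T (a^-1%:C *: x)).
  apply: KT; rewrite nrmZ cmod_id ?invr_ge0 ?(ltW a0)//.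
  rewrite ler_pdivrMl// mulr1 (le_trans xr)//.
  by rewrite (le_trans (ler_norm _))// lerDl.
rewrite (linZ (bounded_op_linear bT)) scalerA -rmorphM/= mulfV ?gt_eqF//.
by rewrite rmorph1 scale1r.
Qed.

Lemma compact_op_compl S T : bounded_op S -> compact_op T -> compact_op (S \o T).
Proof.
move=> bS /compact_opP[bT [K Kc KT]]; apply/compact_opP; split.
  exact: bounded_op_comp.
exists (S @` K); first exact: compact_image.
by move=> x x1 /=; exists (T x) => //; exact: KT.
Qed.

Lemma compact_op_compr T S : compact_op T -> bounded_op S -> compact_op (T \o S).
Proof.
move=> cT /[dup] bS /bounded_opP[_ [M M0 SM]]; apply/compact_opP; split.
  by apply: bounded_op_comp => //; exact: compact_op_bounded.
have [K Kc KT] := compact_op_ball M cT; exists K => // x x1; apply: KT.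
by rewrite (le_trans (SM x))// -[leRHS]mulr1 ler_wpM2l.
Qed.

Lemma compact_set_add (K L : set H) : compact K -> compact L ->
  compact [set x + y | x in K & y in L].
Proof.
move=> Kc Lc; have -> : [set x + y | x in K & y in L] =
    (fun p : H * H => p.1 + p.2) @` (K `*` L).
  apply/seteqP; split=> [_ [x Kx [y Ly <-]]|_ [[x y] [/= Kx Ly] <-]].
    by exists (x, y).
  by exists x => //; exists y.
apply: continuous_compact; last exact: compact_setX.
by apply: continuous_subspaceT => p; exact: add_continuous.
Qed.

Lemma compact_op_addZ (a : R[i]) T S :
  compact_op T -> compact_op S -> compact_op (a *: T + S).
Proof.
move=> cT /compact_opP[bS [L Lc LS]].
have /compact_opP[bT [K Kc KT]] := compact_op_compl (bounded_op_scale a) cT.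
apply/compact_opP; split; first by apply: bounded_op_addZ => //; case: cT.
eexists; first exact: (compact_set_add Kc Lc).
move=> x x1; exists (a *: T x); first exact: KT.
by exists (S x) => //; exact: LS.
Qed.

Lemma compact_op_add T S : compact_op T -> compact_op S -> compact_op (T + S).
Proof. by move=> cT cS; rewrite -[T]scale1r; exact: compact_op_addZ. Qed.

Lemma bounded_op0 : bounded_op (0 : H -> H).
Proof.
apply/bounded_opP; split; first by move=> a x y; rewrite scaler0 addr0.
by exists 0 => // x; rewrite mul0r -(@nrm0 R H).
Qed.

Lemma compact_op0 : compact_op (0 : H -> H).
Proof.
apply/compact_opP; split; first exact: bounded_op0.
by exists [set 0]; [exact: compact_set1|].
Qed.

Lemma compact_op_sum (I : Type) (r : seq I) (F : I -> H -> H) :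
  (forall i, compact_op (F i)) -> compact_op (\sum_(i <- r) F i).
Proof.
move=> cF; apply: big_ind => [|T S|//]; [exact: compact_op0|].
exact: compact_op_add.
Qed.

(** A complex disc lies in a square, so its multiples of w lie in a sum of two
    such sets, one for w and one for i w. *)
Lemma segment_scale_compact (a b : R) (w : H) :
  compact [set s%:C *: w | s in `[a, b]].
Proof.
apply: continuous_compact; last exact: segment_compact.
apply: continuous_subspaceT => s; apply/nrm_cvg => e e0.
have w1 : 0 < nrm w + 1 by rewrite ltr_wpDl ?nrm_ge0.
have : \forall t \near s, `|s - t| < e / (nrm w + 1).
  by apply: (@cvgr_dist_lt _ _ _ (nbhs s) _ id s cvg_id); rewrite divr_gt0.
apply: filterS => t; rewrite ltr_pdivlMr// => h.
rewrite -scalerBl -rmorphB nrmZ cmodR; apply: le_lt_trans h.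
by rewrite ler_wpM2l// lerDl.
Qed.

(** The image of the unit ball lies in the set of all (s + i t) w with s and t in
    a real segment. *)
Lemma compact_op_rank1 (c : R[i]) (u w : H) :
  compact_op (fun x => (c * inner x u) *: w).
Proof.
apply/compact_opP; split.
  apply/bounded_opP; split.
    by move=> a x y; rewrite innerDl innerZl scalerA -scalerDl; congr (_ *: _); ring.
  exists (cmod c * nrm u * nrm w) => [|x]; first by rewrite !mulr_ge0 ?nrm_ge0.
  rewrite nrmZ cmodM [leRHS]mulrAC ler_wpM2r ?nrm_ge0// -mulrA ler_wpM2l ?nrm_ge0//.
  by rewrite mulrC cauchy_schwarz.
pose b := cmod c * nrm u.
eexists; first exact: (compact_set_add (@segment_scale_compact (- b) b w)
  (@segment_scale_compact (- b) b ('i%C *: w))).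
move=> x x1; set z := c * inner x u.
have zb : cmod z <= b.
  rewrite cmodM ler_wpM2l ?nrm_ge0// (le_trans (cauchy_schwarz _ _))//.
  by rewrite -[leRHS]mul1r ler_wpM2r ?nrm_ge0.
have h (t : R) : t ^+ 2 <= cmod z ^+ 2 -> t \in `[- b, b].
  move=> tz; rewrite in_itv/= -ler_norml (le_trans _ zb)//.
  by rewrite -(@ler_pXn2r _ 2)// ?nnegrE ?nrm_ge0// real_normK ?num_real.
have E : cmod z ^+ 2 = complex.Re z ^+ 2 + complex.Im z ^+ 2.
  apply: (@complexI R); rewrite rmorphXn/= -(@nrmE R R[i]^o) -add_Re2_Im2.
  by [].
exists ((complex.Re z)%:C *: w).
  by exists (complex.Re z) => //; apply: h; rewrite E lerDl sqr_ge0.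
exists ((complex.Im z)%:C *: ('i%C *: w)).
  by exists (complex.Im z) => //; apply: h; rewrite E lerDr sqr_ge0.
by rewrite scalerA -scalerDl [in RHS](complexE z) [_ * 'i%C]mulrC.
Qed.

Lemma compact_op_lim T : bounded_op T ->
  (forall eps : R, 0 < eps -> exists2 S, compact_op S &
    forall x, nrm (T x - S x) <= eps * nrm x) -> compact_op T.
Proof.
move=> bT h; split=> //; apply: precompact_approx => e e0.
have [S /compact_opP[bS [K Kc KS]] TS] := h _ (divr_gt0 e0 (ltr0Sn R 1)).
exists K => // _ [x /= x1 <-]; exists (S x).
  by apply: KS; move: x1; rewrite nrmE -(lecR (nrm x) 1).
have {}x1 : nrm x <= 1 by move: x1; rewrite nrmE -(lecR (nrm x) 1).
rewrite (le_lt_trans (TS x))// (@le_lt_trans _ _ (e / 2 * 1))//; last by lra.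
by rewrite ler_wpM2l// divr_ge0// ltW.
Qed.

(** The operator is a norm limit of finite sums of rank-one operators: the
    remainder is again a gdiag, with small coefficients. *)
Lemma gdiag_compact (e : nat -> H) (v : nat -> H) (a : nat -> R[i]) :
  orthonormal_basis e -> orthonormal_family v ->
  (forall eps : R, 0 < eps -> exists N, forall k, (N <= k)%N -> cmod (a k) <= eps) ->
  compact_op (gdiag e v a).
Proof.
move=> eP ov a0.
have [M aM] : exists M, forall k, cmod (a k) <= M.
  have [N aN] := a0 1 ltr01.
  exists (1 + \sum_(k < N) cmod (a k)) => k; have [/aN|kN] := leqP N k.
    by move=> /le_trans; apply; rewrite lerDl sumr_ge0// => *; exact: nrm_ge0.
  rewrite (bigD1 (Ordinal kN))//= addrCA lerDl addr_ge0// sumr_ge0// => *.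
  exact: nrm_ge0.
have bT := gdiag_bounded eP ov aM; apply: compact_op_lim => // eps eps0.
have [N aN] := a0 _ eps0.
pose S : H -> H := \sum_(0 <= k < N) (fun x => (a k * inner x (e k)) *: v k).
have cS : compact_op S by apply: compact_op_sum => k; exact: compact_op_rank1.
exists S => // x.
pose b k := if (k < N)%N then 0 else a k.
have bE k : cmod (b k) <= eps.
  by rewrite /b; case: ltnP => [_|/aN//]; rewrite nrm0 ltW.
suff E : gdiag e v a = S + gdiag e v b.
  have -> : gdiag e v a x = S x + gdiag e v b x by rewrite E.
  by rewrite addrC addKr; have [] := gdiag_spec eP ov bE x.
have bS := compact_op_bounded cS; have bB := gdiag_bounded eP ov bE.
apply: (bounded_op_ext eP) => // [|j].
  by rewrite -[S]scale1r; exact: bounded_op_addZ.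
rewrite fctE !(gdiag_basis eP) /b /S fct_sumE.
have Ee k : inner (e j) (e k) = (j == k)%:R by exact: (basis_orthonormal eP).
have [jN|Nj] := ltnP j N.
  rewrite (bigD1_seq j) ?iota_uniq ?mem_index_iota//= Ee eqxx mulr1.
  rewrite big1 ?addr0 ?scale0r ?addr0// => k kj.
  by rewrite Ee eq_sym (negbTE kj) mulr0 scale0r.
rewrite big_seq big1 ?add0r// => k; rewrite mem_index_iota => /andP[_ kN].
by rewrite Ee gtn_eqF ?mulr0 ?scale0r// (leq_trans kN).
Qed.

End CompactOps.

(** * Singular values of compact operators *)

(** The operator T^* T, whose eigenspaces define the singular values. *)
Definition gram {R : realType} {H : hilbertType R} (T : H -> H) : H -> H :=
  adjoint T \o T.

Section SVD.
Context {R : realType} {H : hilbertType R} {e : nat -> H}.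
Hypothesis eP : orthonormal_basis e.
Implicit Types (x y z : H) (T S : H -> H).

Lemma gramE T x : bounded_op T -> inner (gram T x) x = (nrm (T x) ^+ 2)%:C.
Proof. by move=> bT; rewrite /gram /= (adjointEr eP)// innerxx. Qed.

Lemma gram_sym T x y : bounded_op T -> inner (gram T x) y = inner x (gram T y).
Proof. by move=> bT; rewrite /gram /= (adjointEr eP)// (adjointE eP). Qed.

Lemma gram_bounded T : bounded_op T -> bounded_op (gram T).
Proof. by move=> bT; apply: bounded_op_comp => //; exact: (adjoint_bounded eP). Qed.

(** Orthogonality to n vectors is a system of n equations for n + 1 coefficients. *)
Lemma ortho_complement n (f : nat -> H) (w : 'I_n -> H) : orthonormal_family f ->
  exists c : 'I_n.+1 -> R[i], exists2 x, x = \sum_i c i *: f i &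
    x != 0 /\ forall j, inner x (w j) = 0.
Proof.
move=> of_.
have [c [i ci] cw] := left_kernel (fun (i : 'I_n.+1) j => inner (f i) (w j)) (ltnSn n).
exists c; exists (\sum_i c i *: f i) => //; split=> [|j]; last first.
  by rewrite inner_suml -[RHS](cw j); apply: eq_bigr => k _; rewrite innerZl.
apply: contra ci => /eqP h; have := congr1 (inner^~ (f i)) h.
rewrite /= inner0l inner_suml (bigD1 i)//= innerZl of_ eqxx mulr1 big1 ?addr0.
  by move=> ->.
by move=> k ki; rewrite innerZl of_ (inj_eq val_inj) (negbTE ki) mulr0.
Qed.

Definition orth_to (p : seq H) : set H := [set x | forall w, w \in p -> inner x w = 0].

(** Let s be the supremum of nrm (T x) over the unit vectors x of the complement.
    If nrm (T x) is close to s, then gram T x is close to s^2 x. Along an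
    ultrafilter of such x, T x converges by compactness, so gram T x
    converges, so does x when s > 0, and the limit is an eigenvector. *)
Lemma top_eigenvector T (p : seq H) : compact_op T ->
  (forall x, orth_to p x -> orth_to p (gram T x)) ->
  exists us : H * R, [/\ orth_to p us.1, nrm us.1 = 1, 0 <= us.2,
    gram T us.1 = (us.2 ^+ 2)%:C *: us.1 &
    forall x, orth_to p x -> nrm (T x) <= us.2 * nrm x].
Proof.
move=> cT inv; have bT := compact_op_bounded cT.
have Tl := bounded_op_linear bT; have /bounded_opP[_ [M M0 TM]] := bT.
have Eadd a x y : orth_to p x -> orth_to p y -> orth_to p (a *: x + y).
  by move=> xE yE w wp; rewrite innerDl innerZl xE// yE// mulr0 addr0.
have EZ a x : orth_to p x -> orth_to p (a *: x).
  by move=> xE w wp; rewrite innerZl xE// mulr0.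
pose N := [set r : R | exists x, [/\ orth_to p x, nrm x = 1 & r = nrm (T x)]].
have [u0 [u0E u01]] : exists u0, orth_to p u0 /\ nrm u0 = 1.
  have [c [x _ [x0 xp]]] := ortho_complement (fun i : 'I_(size p) => nth 0 p i)
    (basis_orthonormal eP).
  have nx : 0 < nrm x by rewrite lt_def nrm_ge0 nrm_eq0 x0.
  exists ((nrm x)^-1%:C *: x); split.
    apply: EZ => w /(nthP 0)[i ip <-].
    exact: (xp (Ordinal ip)).
  by rewrite nrmZ cmod_id ?invr_ge0 ?ltW// mulVf// gt_eqF.
have Nub : has_ubound N.
  by exists M => _ [x [_ x1 ->]]; rewrite (le_trans (TM x))// x1 mulr1.
pose s := sup N.
have Ns r : N r -> r <= s by move=> Nr; exact: ub_le_sup.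
have s0 : 0 <= s.
  by apply: le_trans (nrm_ge0 (T u0)) (Ns _ _); exists u0; split.
have sT x : orth_to p x -> nrm (T x) <= s * nrm x.
  move=> xE; have [->|x0] := eqVneq x 0.
    by rewrite (lin0 Tl) nrm0 mulr0.
  have nx : 0 < nrm x by rewrite lt_def nrm_ge0 nrm_eq0 x0.
  rewrite -ler_pdivrMr// mulrC; apply: Ns; exists ((nrm x)^-1%:C *: x).
  by rewrite (linZ Tl) !nrmZ cmod_id ?invr_ge0 ?(ltW nx)// mulVf ?gt_eqF//; split=> //;
     exact: EZ.
(* For s = 0 the operator vanishes on the complement and any unit vector will do. *)
have [sE|sn0] := eqVneq s 0.
  exists (u0, 0) => /=; split=> //; last by move=> x /sT; rewrite sE.
  have /eqP : nrm (T u0) == 0 by rewrite eq_le nrm_ge0 (le_trans (sT _ u0E))// sE mul0r.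
  rewrite expr0n/= scale0r /gram /= => /eqP; rewrite nrm_eq0 => /eqP ->.
  exact: lin0 (bounded_op_linear (adjoint_bounded eP bT)).
have sp : 0 < s by rewrite lt_def sn0.
pose B (r : R) := [set x | [/\ orth_to p x, nrm x = 1 & s - r < nrm (T x)]].
have GF : ProperFilter (filter_from [set r : R | 0 < r] B).
  apply: filter_from_proper.
    apply: filter_from_filter; first by exists 1; exact: ltr01.
    move=> i j /= i0 j0; exists (Num.min i j); first by rewrite /= lt_min i0.
    move=> x [xE x1 xs]; split; split=> //; apply: le_lt_trans xs;
      by rewrite lerD2l lerN2 ge_min lexx ?orbT.
  move=> r /= r0; have hN : has_sup N by split=> //; exists (nrm (T u0)), u0.
  by have [_ [x [xE x1 ->]] xs] := sup_adherent r0 hN; exists x.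
have [U [UU GU]] := ultraFilterLemma GF.
have UB r : 0 < r -> U (B r) by move=> r0; apply: GU; exists r.
have /compact_opP[_ [K Kc KT]] := cT.
have [|y _ Ty] := ultra_compact_cvg (u := T) Kc UU.
  by apply: filterS (UB _ ltr01) => x [_ x1 _]; apply: KT; rewrite x1.
have bA := adjoint_bounded eP bT.
have Aw : (gram T) @ U --> adjoint T y by exact: (bounded_op_cvg bA Ty).
(* Expand the square and use nrm (gram T x) <= s * nrm (T x), which holds because
   gram T x stays in the complement. *)
have defect x : orth_to p x -> nrm x = 1 ->
    nrm (gram T x - (s ^+ 2)%:C *: x) ^+ 2 <= s ^+ 2 * (s ^+ 2 - nrm (T x) ^+ 2).
  move=> xE x1.
  have nA : nrm (gram T x) <= s * nrm (T x).
    have [->|A0] := eqVneq (gram T x) 0; first by rewrite nrm0 mulr_ge0 ?nrm_ge0.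
    rewrite -(@ler_pM2r _ (nrm (gram T x))) ?lt_def ?nrm_eq0 ?A0 ?nrm_ge0//.
    rewrite -expr2 -[leLHS]cmod_id ?sqr_ge0// -innerxx.
    rewrite {1}/gram /= (adjointEr eP)// (le_trans (cauchy_schwarz _ _))//.
    apply: le_trans (ler_wpM2l (nrm_ge0 (T x)) (sT _ (inv _ xE))) _.
    by rewrite mulrA [X in X * _]mulrC.
  have -> : nrm (gram T x - (s ^+ 2)%:C *: x) ^+ 2 =
      nrm (gram T x) ^+ 2 - 2 * s ^+ 2 * nrm (T x) ^+ 2 + (s ^+ 2) ^+ 2.
    apply: (@complexI R); rewrite -innerxx innerBl !innerBr !innerZl !innerZr.
    rewrite [inner x (gram T x)]innerC gramE// !innerxx x1.
    rewrite !conjR.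
    rewrite !(rmorphD, rmorphN, rmorphM, rmorphXn, rmorph1)/=; ring.
  have nA2 : nrm (gram T x) ^+ 2 <= s ^+ 2 * nrm (T x) ^+ 2.
    by rewrite -exprMn ler_pXn2r ?nnegrE ?mulr_ge0 ?nrm_ge0.
  by lra.
have xw : (fun x => (s ^+ 2)%:C *: x) @ U --> adjoint T y.
  apply/nrm_cvg => r r0; have r2 : 0 < r / 2 by rewrite divr_gt0.
  move/nrm_cvg in Aw.
  have d0 : 0 < (r / 2) ^+ 2 / (2 * s ^+ 3) by rewrite divr_gt0 ?mulr_gt0 ?exprn_gt0.
  apply: filterS2 (Aw _ r2) (UB _ d0) => x Ax [xE x1 xs].
  have : nrm (gram T x - (s ^+ 2)%:C *: x) < r / 2.
    rewrite -(@ltr_pXn2r _ 2)// ?nnegrE ?nrm_ge0 ?(ltW r2)//.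
    apply: le_lt_trans (defect _ xE x1) _.
    have Tx : nrm (T x) <= s by have := sT _ xE; rewrite x1 mulr1.
    move: xs; rewrite ltrBlDr -ltrBlDl ltr_pdivlMr ?mulr_gt0 ?exprn_gt0//.
    move=> h; apply: le_lt_trans h; 
    rewrite -subr_ge0 (_ : _ - _ = (s * (s - nrm (T x))) ^+ 2) ?sqr_ge0//; ring.
  have := nrmD (adjoint T y - gram T x) (gram T x - (s ^+ 2)%:C *: x).
  by rewrite addrA subrK; lra.
pose u := (s ^- 2)%:C *: adjoint T y.
have xu : id @ U --> u.
  have h := bounded_op_cvg (bounded_op_scale (H := H) (s ^- 2)%:C) xw.
  suff E : (fun x : H => (s ^- 2)%:C *: x) \o (fun x => (s ^+ 2)%:C *: x) = id.
    by rewrite -E; exact: h.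
  apply/funext => x /=; rewrite scalerA -rmorphM mulVf ?scale1r//.
  by rewrite gt_eqF// exprn_gt0.
exists (u, s); split => //=.
- move=> w wp; apply: (inner_lim xu).
  by apply: filterS (UB _ ltr01) => x [xE _ _]; exact: xE.
- apply/eqP; rewrite eq_le; apply/andP; split.
    by apply: (nrm_lim_le xu); apply: filterS (UB _ ltr01) => x [_ -> _].
  by apply: (nrm_lim_ge xu); apply: filterS (UB _ ltr01) => x [_ -> _].
- have h1 := bounded_op_cvg (gram_bounded bT) xu.
  rewrite [RHS](_ : _ = adjoint T y).
    by apply: (@cvg_unique _ (@hilbert_hausdorff R H) (gram T @ U));
      [exact: h1|exact: Aw].
  rewrite /u scalerA -rmorphM mulfV ?scale1r//.
  by rewrite gt_eqF// exprn_gt0.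
Qed.

End SVD.

(** The vectors v are right singular vectors. The bound on complements says that
    s n is the norm of T away from v 0, ..., v (n-1); with svd_small it makes
    v complete up to the kernel of T. *)
Record svd {R : realType} {H : hilbertType R} (T : H -> H) (v : nat -> H)
    (s : nat -> R) : Prop := Svd {
  svd_on : orthonormal_family v;
  svd_ge0 : forall k, 0 <= s k;
  svd_noninc : forall j k, (j <= k)%N -> s k <= s j;
  svd_eigen : forall k, gram T (v k) = (s k ^+ 2)%:C *: v k;
  svd_bound : forall n x, (forall j, (j < n)%N -> inner x (v j) = 0) ->
    nrm (T x) <= s n * nrm x;
  svd_small : forall eps : R, 0 < eps -> exists n, s n < eps }.

Section SVD2.
Context {R : realType} {H : hilbertType R} {e : nat -> H}.
Hypothesis eP : orthonormal_basis e.
Implicit Types (x y z : H) (T S : H -> H).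

(** Apply top_eigenvector repeatedly, to the complement of the vectors already
    chosen. The values tend to 0: the vectors T (v n) are pairwise
    orthogonal, so any limit of them along an ultrafilter is 0. *)
Lemma svd_exists T : compact_op T -> exists v s, svd T v s.
Proof.
move=> cT; have bT := compact_op_bounded cT.
pose good (p : seq H) := forall w, w \in p -> exists r : R, gram T w = r%:C *: w.
have goodE p : good p -> forall x, orth_to p x -> orth_to p (gram T x).
  move=> gp x xp w wp; rewrite (gram_sym eP)//; have [r ->] := gp w wp.
  by rewrite innerZr xp// mulr0.
(* The pair (0, 0) is a dummy value for lists that are not lists of eigenvectors. *)
have /choice[F FP] : forall p, exists us : H * R, good p -> [/\ orth_to p us.1,
    nrm us.1 = 1, 0 <= us.2, gram T us.1 = (us.2 ^+ 2)%:C *: us.1 &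
    forall x, orth_to p x -> nrm (T x) <= us.2 * nrm x].
  move=> p; have [gp|ngp] := pselect (good p); last by exists (0, 0).
  by have [us h] := top_eigenvector eP cT (goodE _ gp); exists us.
pose pre := fix pre n := if n is m.+1 then rcons (pre m) (F (pre m)).1 else [::].
pose v n := (F (pre n)).1; pose s n := (F (pre n)).2.
have mem_pre n w : (w \in pre n) <-> exists2 k, (k < n)%N & w = v k.
  elim: n w => [|n IH] w /=; first by split=> // -[].
  rewrite mem_rcons inE; split=> [/orP[/eqP ->|/IH[k kn ->]]|[k]].
  - by exists n.
  - by exists k => //; exact: ltnW.
  - rewrite ltnS leq_eqVlt => /orP[/eqP -> ->|kn wk]; first by rewrite eqxx.
    by apply/orP; right; apply/IH; exists k.
have goodpre n : good (pre n).
  elim: n => [|n IH] w //=; rewrite mem_rcons inE => /orP[/eqP ->|/IH//].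
  by have [_ _ _ h _] := FP _ IH; exists ((F (pre n)).2 ^+ 2).
have vP n := FP _ (goodpre n).
have orthP n x : orth_to (pre n) x <-> forall j, (j < n)%N -> inner x (v j) = 0.
  split=> [h j jn|h w /mem_pre[k kn ->]]; last exact: h.
  by apply: h; apply/mem_pre; exists j.
have s0 n : 0 <= s n by have [] := vP n.
have nv n : nrm (v n) = 1 by have [] := vP n.
have vlt j k : (j < k)%N -> inner (v k) (v j) = 0.
  by move=> jk; have [+ _ _ _ _] := vP k; move=> /orthP; exact.
have ov : orthonormal_family v.
  move=> j k; have [<-|jk] := eqVneq j k; first by rewrite innerxx nv expr1n.
  move: jk; rewrite neq_ltn => /orP[jk|kj]; last exact: vlt.
  by rewrite innerC vlt// rmorph0.
have Av k : gram T (v k) = (s k ^+ 2)%:C *: v k by have [] := vP k.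
have bnd n x : (forall j, (j < n)%N -> inner x (v j) = 0) -> nrm (T x) <= s n * nrm x.
  by move=> /orthP xn; have [_ _ _ _ h] := vP n; exact: h.
have nT k : nrm (T (v k)) = s k.
  apply/eqP; rewrite -(@eqrXn2 _ 2)// ?nrm_ge0//; apply/eqP/(@complexI R).
  by rewrite -(gramE eP)// Av innerZl innerxx nv expr1n mulr1.
have sinc j k : (j <= k)%N -> s k <= s j.
  move=> jk; rewrite -nT -[leRHS]mulr1 -(nv k); apply: bnd => i ij.
  by apply: vlt; exact: leq_trans ij jk.
exists v, s; split=> // eps eps0.
apply: contrapT => /forallNP h.
have {}h n : eps <= s n by rewrite leNgt; apply/negP; exact: h.
have [U [UU GU]] := @ultraFilterLemma _ \oo _.
have /compact_opP[_ [K Kc KT]] := cT.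
have [|y _ Ty] := ultra_compact_cvg (u := T \o v) Kc UU.
  by apply: filterE => n /=; apply: KT; rewrite nv.
have y0 m : inner y (T (v m)) = 0.
  apply: (inner_lim Ty); apply: GU; exists m.+1 => // n /= mn.
  by rewrite (adjointE eP)// -[adjoint T (T _)]/(gram T (v m)) Av innerZr vlt// mulr0.
have : inner y y = 0.
  apply: (inner_lim Ty); apply: filterE => n /=.
  by rewrite innerC y0 rmorph0.
move=> /innerxx0 yE; have : eps <= nrm y.
  by apply: (nrm_lim_ge Ty); apply: filterE => n /=; rewrite nT.
by rewrite yE nrm0 leNgt eps0.
Qed.

(** The eigenspace for t^2 is spanned by the v k with s k = t: an eigenvector y
    orthogonal to these is orthogonal to all v k, so nrm (T y) is at most s n
    * nrm y for each n, but it equals t * nrm y. *)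
Lemma svd_singular T v s : bounded_op T -> svd T v s -> singular_sequence T s.
Proof.
move=> bT sv; split; [exact: svd_ge0 sv|exact: svd_noninc sv|move=> t t0].
have [N sN] := svd_small sv t0.
have : finite_set [set k | s k = t].
  apply: (@sub_finite_set _ _ `I_N); last exact: finite_II.
  move=> k /= skt; rewrite ltnNge; apply/negP => Nk.
  by have := svd_noninc sv Nk; rewrite skt leNgt sN.
move=> /finite_setP[n cn_]; exists n => //.
have /card_set_bijP[f [fA finj fsurj]] : (`I_n #= [set k | s k = t])%card
  by rewrite card_eq_sym.
have ov : orthonormal_family (fun i : 'I_n => v (f i)).
  move=> i j; rewrite (svd_on sv); congr (nat_of_bool _)%:R.
  apply/eqP/eqP => [fij|->//]; apply/val_inj/finj => //; rewrite inE/=; exact: ltn_ord.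
exists (fun i => v (f i)); split.
  move=> c c0 i; have := orthonormal_inner_sum
    (r := index_enum _) c i ov (index_enum_uniq _).
  by rewrite c0 inner0l mem_index_enum.
apply/seteqP; split=> x; rewrite /eigenspace_op /=; last first.
  move=> /linspan_range[c ->]; rewrite -[adjoint T (T _)]/(gram T _).
  rewrite (lin_sum (bounded_op_linear (gram_bounded eP bT))) scaler_sumr.
  apply: eq_bigr => i _.
  rewrite (linZ (bounded_op_linear (gram_bounded eP bT))) (svd_eigen sv).
  by rewrite (fA i (ltn_ord i)) scalerA mulrC -scalerA.
rewrite -[adjoint T (T _)]/(gram T x) => Ax; apply/linspan_range.
exists (fun i => inner x (v (f i))).
apply/eqP; rewrite -subr_eq0; set y := x - _.
have yv j : inner y (v j) = 0.
  have [sj|sj] := eqVneq (s j) t.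
    have [i /= ni <-] := fsurj j sj.
    rewrite innerBl (orthonormal_inner_sum (r := index_enum _)
      (fun i : 'I_n => inner x (v (f i))) (Ordinal ni) ov (index_enum_uniq _)).
    by rewrite mem_index_enum subrr.
  rewrite innerBl inner_suml [X in _ - X]big1 ?subr0; last first.
    move=> i _; rewrite innerZl (svd_on sv).
    have [fij|] := eqVneq (f i) j; last by rewrite mulr0.
    by case/eqP: sj; rewrite -fij; exact: fA (ltn_ord i).
  have := gram_sym eP x (v j) bT.
  rewrite Ax (svd_eigen sv) innerZl innerZr conjR => /eqP.
  rewrite -subr_eq0 -mulrBl mulf_eq0 => /orP[|/eqP//].
  rewrite -rmorphB -[0]/(0%:C) (inj_eq (@complexI R)) subr_eq0.
  rewrite eqrXn2 ?(ltW t0) ?(svd_ge0 sv)// => /eqP tj.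
  by rewrite tj eqxx in sj.
have Ay : gram T y = (t ^+ 2)%:C *: y.
  rewrite /y (linB (bounded_op_linear (gram_bounded eP bT))) Ax scalerBr; congr (_ - _).
  rewrite (lin_sum (bounded_op_linear (gram_bounded eP bT))) scaler_sumr.
  apply: eq_bigr => i _.
  rewrite (linZ (bounded_op_linear (gram_bounded eP bT))) (svd_eigen sv).
  by rewrite (fA i (ltn_ord i)) scalerA mulrC -scalerA.
have : nrm (T y) ^+ 2 = t ^+ 2 * nrm y ^+ 2.
  apply: (@complexI R); rewrite -(gramE eP)// Ay innerZl innerxx.
  by rewrite -rmorphM.
rewrite -exprMn => /eqP; rewrite eqrXn2 ?mulr_ge0 ?nrm_ge0 ?(ltW t0)// => /eqP Ty.
have := svd_bound sv (n := N) (x := y) (fun j _ => yv j); rewrite Ty.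
apply: contraLR => y0; rewrite -ltNge ltr_pM2r//.
by rewrite lt_def nrm_ge0 nrm_eq0 y0.
Qed.

End SVD2.

Lemma card_sub_eq (A B : set nat) n : A `<=` B -> (A #= `I_n)%card ->
  (B #= `I_n)%card -> B `<=` A.
Proof.
move=> AB cA cB.
have fA : finite_set A by apply/finite_setP; exists n.
have fB : finite_set B by apply/finite_setP; exists n.
have /fsetP E : fset_set A =i fset_set B.
  apply: fsubset_cardP; last by rewrite -fset_set_sub.
  by rewrite (card_fset_set cA) (card_fset_set cB).
by rewrite -(fset_setK fA) -(fset_setK fB) E.
Qed.

Section Singular.
Context {R : realType} {H : hilbertType R}.

(** If k is the first index where they differ and s k is larger, the value s k
    would occur strictly fewer times in s' than in s. *)
Lemma singular_uniq_le (T : H -> H) s s' k : singular_sequence T s ->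
  singular_sequence T s' -> (forall j, (j < k)%N -> s j = s' j) -> s k <= s' k.
Proof.
move=> [s0 sinc sd] [s'0 s'inc s'd] IH; rewrite leNgt; apply/negP => ks.
have t0 : 0 < s k by exact: le_lt_trans (s'0 k) ks.
have [n dn cn_] := sd _ t0; have [n' dn' cn'] := s'd _ t0.
have nn := has_dim_uniq dn dn'; subst n'.
have /(_ k erefl) /= : [set j | s j = s k] `<=` [set j | s' j = s k].
  apply: card_sub_eq cn' cn_ => j /= s'j.
  have [jk|kj] := ltnP j k; first by rewrite IH.
  by have := s'inc _ _ kj; rewrite s'j leNgt ks.
by move=> s'k; rewrite s'k ltxx in ks.
Qed.

Lemma singular_uniq (T : H -> H) s s' : singular_sequence T s ->
  singular_sequence T s' -> s = s'.
Proof.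
move=> hs hs'; apply/funext; elim/ltn_ind => k IH.
apply/eqP; rewrite eq_le (singular_uniq_le hs hs' IH) (singular_uniq_le hs' hs)//.
by move=> j jk; rewrite IH.
Qed.

End Singular.

(** * The ideal of operators with singular values O(1/k) *)

Section Weak.
Context {R : realType} {H : hilbertType R} {e : nat -> H}.
Hypothesis eP : orthonormal_basis e.
Implicit Types (x y z : H) (T S : H -> H).

Lemma mu_svd T v s k : compact_op T -> svd T v s -> mu k T = s k.
Proof.
move=> cT sv; have ss := svd_singular eP (compact_op_bounded cT) sv.
have : exists s, singular_sequence T s by exists s.
by move=> /getPex h; rewrite /mu (singular_uniq h ss).
Qed.

(** T has approximation numbers O(1/n). Lists of at most n vectors, rather than
    families indexed by n, make sums of operators a matter of concatenation. *)
Definition harmonic_approx (T : H -> H) := exists2 C : R, 0 <= C &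
  forall n, exists2 p : seq H, (size p <= n)%N &
    forall x, orth_to p x -> nrm (T x) <= C / n.+1%:R * nrm x.

(** One direction takes the first n singular vectors. Conversely n vectors cannot
    have a trivial complement in the span of v 0, ..., v n, and on that span
    nrm (T x) >= s n * nrm x. *)
Lemma weak_L1P T : weak_L1 T <-> compact_op T /\ harmonic_approx T.
Proof.
split=> -[cT]; have bT := compact_op_bounded cT; have [v [s sv]] := svd_exists eP cT.
  move=> [M TM]; split=> //; have M0 : 0 <= M.
    by have := TM 0%N; rewrite (mu_svd _ cT sv) invr1 mulr1;
      apply: le_trans (svd_ge0 sv 0%N).
  exists M => // n; exists (mkseq v n); first by rewrite size_mkseq.
  move=> x xp; apply: le_trans (svd_bound sv (n := n) _) _.
    by move=> j jn; apply: xp; apply/mapP; exists j; rewrite ?mem_iota.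
  by rewrite ler_wpM2r ?nrm_ge0// -(mu_svd n cT sv).
move=> [C C0 TC]; split=> //; exists C => k; rewrite (mu_svd k cT sv).
have [p pk Tp] := TC k.
have [c [x xE [x0 xp]]] := ortho_complement (fun i : 'I_k => nth 0 p i) (svd_on sv).
have {Tp}xp : nrm (T x) <= C / k.+1%:R * nrm x.
  apply: Tp => w /(nthP 0)[i ip <-].
  exact: (xp (Ordinal (leq_trans ip pk))).
have nx : 0 < nrm x by rewrite lt_def nrm_ge0 nrm_eq0 x0.
rewrite -(ler_pM2r nx); apply: le_trans xp.
rewrite -(@ler_pXn2r _ 2)// ?nnegrE ?mulr_ge0 ?nrm_ge0 ?(svd_ge0 sv)// exprMn.
have ov : orthonormal_family (fun i : 'I_k.+1 => v i).
  by move=> i j; rewrite (svd_on sv).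
have -> : nrm (T x) ^+ 2 = \sum_(i < k.+1) s i ^+ 2 * cmod (c i) ^+ 2.
  apply: (@complexI R); rewrite -(gramE eP)// [in gram T x]xE.
  rewrite (lin_sum (bounded_op_linear (gram_bounded eP bT))) inner_suml rmorph_sum/=.
  apply: eq_bigr => i _.
  rewrite (linZ (bounded_op_linear (gram_bounded eP bT))) (svd_eigen sv).
  rewrite scalerA innerZl innerC xE.
  rewrite (orthonormal_inner_sum (r := index_enum _) _ _ ov (index_enum_uniq _)).
  rewrite mem_index_enum mulrAC -cmod_sqr -rmorphM; congr _%:C; exact: mulrC.
rewrite xE (orthonormal_nrm_sum (r := index_enum _) _ ov (index_enum_uniq _)) mulr_sumr.
apply: ler_sum => i _; rewrite ler_wpM2r ?sqr_ge0//.
rewrite ler_pXn2r ?nnegrE ?(svd_ge0 sv)//; apply: (svd_noninc sv).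
by rewrite -ltnS.
Qed.

Lemma weak_L1_compact T : weak_L1 T -> compact_op T. Proof. by case. Qed.
Lemma weak_L1_bounded T : weak_L1 T -> bounded_op T. Proof. by case=> -[]. Qed.

Lemma weak_L1_compl S T : bounded_op S -> weak_L1 T -> weak_L1 (S \o T).
Proof.
move=> bS /weak_L1P[cT [C C0 TC]]; apply/weak_L1P; split.
  exact: compact_op_compl.
have /bounded_opP[_ [M M0 SM]] := bS; exists (M * C); first exact: mulr_ge0.
move=> n; have [p pn pT] := TC n; exists p => // x xp /=.
by rewrite (le_trans (SM _))// -!mulrA ler_wpM2l// mulrA pT.
Qed.

(** If x is orthogonal to the image of p under the adjoint of S, then S x is
    orthogonal to p. *)
Lemma weak_L1_compr T S : weak_L1 T -> bounded_op S -> weak_L1 (T \o S).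
Proof.
move=> /weak_L1P[cT [C C0 TC]] bS; apply/weak_L1P; split.
  exact: compact_op_compr.
have /bounded_opP[_ [M M0 SM]] := bS; exists (C * M); first exact: mulr_ge0.
move=> n; have [p pn pT] := TC n; exists (map (adjoint S) p).
  by rewrite size_map.
move=> x xp /=; apply: le_trans (pT _ _) _.
  by move=> w wp; rewrite (adjointE eP)// xp//; exact: map_f.
by rewrite [C * M / _]mulrAC -[leRHS]mulrA ler_wpM2l ?divr_ge0.
Qed.

Lemma weak_L1_addZ a T S : weak_L1 T -> weak_L1 S -> weak_L1 (a *: T + S).
Proof.
move=> /weak_L1P[cT [C C0 TC]] /weak_L1P[cS [D D0 SD]]; apply/weak_L1P; split.
  exact: compact_op_addZ.
exists (2 * (cmod a * C + D)).
  by rewrite mulr_ge0// addr_ge0// mulr_ge0// nrm_ge0.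
(* Half of the n vectors serve each operator; since n + 1 <= 2 (n/2 + 1), this
   costs a factor 2. *)
move=> n; have [p pn pT] := TC n./2; have [q qn qS] := SD n./2.
exists (p ++ q).
  rewrite size_cat (leq_trans (leq_add pn qn))// addnn -[leqRHS]odd_double_half.
  exact: leq_addl.
move=> x xpq.
have xp : orth_to p x by move=> w wp; apply: xpq; rewrite mem_cat wp.
have xq : orth_to q x by move=> w wp; apply: xpq; rewrite mem_cat wp orbT.
rewrite !fctE (le_trans (nrmD _ _))// nrmZ.
apply: (@le_trans _ _ (cmod a * (C / n./2.+1%:R * nrm x) + D / n./2.+1%:R * nrm x)).
  by rewrite lerD ?qS// ler_wpM2l ?nrm_ge0// pT.
rewrite !mulrA -mulrDl -mulrDl ler_wpM2r ?nrm_ge0//.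
rewrite [2 * _]mulrC -mulrA ler_wpM2l//.
  by rewrite addr_ge0// mulr_ge0// nrm_ge0.
rewrite ler_pdivlMr ?ltr0n// mulrC ler_pdivrMr ?ltr0n// -natrM ler_nat.
rewrite -[n in (n < _)%N]odd_double_half -muln2 mulnC mulnS ltnS.
by rewrite (leq_add (leq_b1 _)).
Qed.

Lemma weak_L1_0 : weak_L1 (0 : H -> H).
Proof.
apply/weak_L1P; split; first exact: compact_op0.
exists 0 => // n; exists [::] => // x _; rewrite !mul0r.
by rewrite -(@nrm0 R H).
Qed.

Lemma weak_L1_add T S : weak_L1 T -> weak_L1 S -> weak_L1 (T + S).
Proof. by move=> wT wS; rewrite -[T]scale1r; exact: weak_L1_addZ. Qed.

Lemma weak_L1_Z a T : weak_L1 T -> weak_L1 (a *: T).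
Proof. by move=> wT; rewrite -[_ *: T]addr0; exact: weak_L1_addZ weak_L1_0. Qed.

Lemma weak_L1_sub T S : weak_L1 T -> weak_L1 S -> weak_L1 (T - S).
Proof.
by move=> wT wS; rewrite addrC -scaleN1r; exact: weak_L1_addZ.
Qed.

End Weak.

(** * The harmonic diagonal operator *)

Section Positive.
Context {R : realType} {H : hilbertType R}.
Implicit Types (x y z : H) (T S : H -> H).

(** Polarisation: the quadratic form is real at x + y and at x + i y. *)
Lemma positive_sym T : linear T -> positive_op T ->
  forall x y, inner (T x) y = inner x (T y).
Proof.
move=> Tl Tp x y.
have re z : Num.conj (inner (T z) z) = inner (T z) z.
  by apply/CrealP/ger0_real/Tp.
set p := inner (T x) y; pose q := inner (T y) x.
have qE : inner x (T y) = Num.conj q by rewrite innerC.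
have h1 : Num.conj p + Num.conj q = p + q.
  have := re (x + y); rewrite (linD Tl) !innerDl !innerDr -/p -/q !rmorphD/= !re.
  by move=> h; apply: (@addrI _ (inner (T x) x)); apply: (@addIr _ (inner (T y) y));
    move: h; rewrite !addrA.
pose ii : R[i] := 'i.
have iE : Num.conj ii = - ii by exact: conjCi.
have i0 : ii != 0 by exact: neq0Ci.
have h2 : ii * Num.conj p - ii * Num.conj q = - ii * p + ii * q.
  have := re (x + ii *: y).
  rewrite (linD Tl) (linZ Tl) !innerDl !innerDr !innerZl !innerZr -/p -/q.
  rewrite !(rmorphD, rmorphM)/= conjCK !re iE => h.
  move/eqP: h; rewrite -subr_eq0 => /eqP h.
  by apply: subr0_eq; rewrite -[RHS]h; ring.
rewrite qE; apply: (@mulfI _ (2 * ii)); first by rewrite mulf_neq0// pnatr_eq0.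
have -> : 2 * ii * p = ii * (p + q) - (- ii * p + ii * q) by ring.
by rewrite -h1 -h2; ring.
Qed.

End Positive.

Section Harmonic.
Context {R : realType}.

Lemma harmC k : ((k.+1%:R)^-1 : R[i]) = ((k.+1%:R)^-1 : R)%:C.
Proof. by rewrite fmorphV rmorph_nat. Qed.

Lemma harm_anti j k : (j <= k)%N -> (k.+1%:R)^-1 <= (j.+1%:R)^-1 :> R.
Proof. by move=> jk; rewrite lef_pV2 ?posrE ?ltr0n// ler_nat. Qed.

Lemma harm_small (eps : R) : 0 < eps ->
  exists N, forall k, (N <= k)%N -> (k.+1%:R)^-1 < eps.
Proof.
move=> e0; have [N _ HN] := @cvgr_dist_lt _ _ _ _ _ _ _ (@cvg_harmonic R) eps e0.
exists N => k Nk; have := HN k Nk; rewrite /= sub0r normrN ger0_norm//.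
Qed.

End Harmonic.

Section Diag.
Context {R : realType} {H : hilbertType R} {e : nat -> H}.
Hypothesis eP : orthonormal_basis e.
Implicit Types (x y z : H) (T S : H -> H).

(** Coefficients at the coordinates where x vanishes may be replaced by 0. *)
Lemma gdiag_tail (v : nat -> H) (a : nat -> R[i]) n (c : R) x : orthonormal_family v ->
  (forall j, (j < n)%N -> inner x (e j) = 0) ->
  (forall k, (n <= k)%N -> cmod (a k) <= c) ->
  nrm (gdiag e v a x) <= c * nrm x.
Proof.
move=> ov xn ac; pose b k := if (k < n)%N then 0 else a k.
have c0 : 0 <= c by apply: le_trans (nrm_ge0 _) (ac n (leqnn _)).
have bc k : cmod (b k) <= c.
  by rewrite /b; case: ltnP => [_|/ac//]; rewrite nrm0.
have -> : gdiag e v a x = gdiag e v b x.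
  rewrite /gdiag; congr (limn (series _)); apply/funext => k; rewrite /b.
  by case: ltnP => // /xn ->; rewrite !mulr0.
by have [] := gdiag_spec eP ov bc x.
Qed.

Lemma gdiag_self_adjoint (a : nat -> R) M : (forall k, `|a k| <= M) ->
  adjoint (gdiag e e (fun k => (a k)%:C)) = gdiag e e (fun k => (a k)%:C).
Proof.
move=> aM; have oe := basis_orthonormal eP.
have cM k : cmod (a k)%:C <= M by rewrite cmodR.
have bD := gdiag_bounded eP oe cM.
apply: (bounded_op_ext eP) => // [|k]; first exact: (adjoint_bounded eP).
apply: inner_inj => z; rewrite -(adjointE eP)// (gdiag_basis eP) innerZr conjR.
by have [_ -> _] := gdiag_spec eP oe cM z.
Qed.

Local Notation D := (diag e (fun k => (k.+1%:R)^-1)).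

Lemma harmD : D = gdiag e e (fun k => ((k.+1%:R)^-1 : R)%:C).
Proof.
rewrite /diag /gdiag; apply/funext => x; congr (limn (series _)).
by apply/funext => k; rewrite harmC.
Qed.

Let harm_norm (k : nat) : `|(k.+1%:R)^-1 : R| <= 1.
Proof. by rewrite ger0_norm// -[leRHS]invr1 (harm_anti (leq0n k)). Qed.

Let harm_cn (k : nat) : cmod (((k.+1%:R)^-1 : R)%:C) <= 1.
Proof. by rewrite cmodR. Qed.

Lemma harmD_bounded : bounded_op D.
Proof. by rewrite harmD; exact: gdiag_bounded (basis_orthonormal eP) harm_cn. Qed.

Lemma harmD_basis j : D (e j) = ((j.+1%:R)^-1 : R)%:C *: e j.
Proof. by rewrite harmD (gdiag_basis eP). Qed.

Lemma harmD_adjoint : adjoint D = D.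
Proof. by rewrite harmD; exact: gdiag_self_adjoint harm_norm. Qed.

Lemma harmD_compact : compact_op D.
Proof.
rewrite harmD; apply: (gdiag_compact eP (basis_orthonormal eP)) => eps e0.
by have [N HN] := harm_small e0; exists N => k /HN; rewrite cmod_id//; exact: ltW.
Qed.

Lemma harmD_svd : svd D e (fun k => (k.+1%:R)^-1).
Proof.
have bD := harmD_bounded.
split; [exact: basis_orthonormal eP|by []|exact: harm_anti| | |].
- move=> k; rewrite /gram /= harmD_adjoint harmD_basis (linZ (bounded_op_linear bD)).
  by rewrite harmD_basis scalerA -rmorphM -expr2.
- move=> n x xn; rewrite harmD; apply: (gdiag_tail (basis_orthonormal eP) xn) => k nk.
  by rewrite cmod_id//; exact: harm_anti.
- by move=> eps /harm_small[N HN]; exists N; exact: HN.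
Qed.

Lemma harmD_mu k : mu k D = (k.+1%:R)^-1.
Proof. by rewrite (mu_svd eP k harmD_compact harmD_svd). Qed.

Lemma harmD_weak : weak_L1 D.
Proof.
by split; [exact: harmD_compact|exists 1 => k; rewrite harmD_mu mul1r].
Qed.

(** D is the square of the self-adjoint diagonal operator with entries the square
    roots. *)
Lemma harmD_positive : positive_op D.
Proof.
pose b k := Num.sqrt ((k.+1%:R)^-1 : R); pose B := gdiag e e (fun k => (b k)%:C).
have bb k : `|b k| <= 1.
  by rewrite ger0_norm ?sqrtr_ge0// -[leRHS]sqrtr1 ler_wsqrtr// -[leLHS]ger0_norm.
have cb k : cmod (b k)%:C <= 1 by rewrite cmodR.
have bB : bounded_op B := gdiag_bounded eP (basis_orthonormal eP) cb.
have BB : adjoint B = B by exact: gdiag_self_adjoint bb.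
have Be k : B (e k) = (b k)%:C *: e k by exact: (gdiag_basis eP).
have -> : D = B \o B.
  apply: (bounded_op_ext eP) => //[||k]; [exact: harmD_bounded|exact: bounded_op_comp|].
  rewrite /= Be (linZ (bounded_op_linear bB)) Be harmD_basis.
  by rewrite scalerA -rmorphM -expr2 sqr_sqrtr.
move=> x; rewrite /= (adjointE eP)// BB innerxx.
by rewrite ler0c sqr_ge0.
Qed.

(** Let V send e k to the singular vector v k. Positivity turns the eigenvectors
    of T^* T = T^2 into eigenvectors of T, so T V = V D; and T vanishes on
    the range of 1 - V V^*, which is orthogonal to all v k. *)
Lemma harmonic_structure T : weak_L1 T -> positive_op T ->
  (forall k, mu k T = (k.+1%:R)^-1) ->
  exists V, [/\ bounded_op V, adjoint V \o V = id & T = V \o D \o adjoint V].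
Proof.
move=> wT pT mT; have cT := weak_L1_compact wT; have bT := weak_L1_bounded wT.
have Tl := bounded_op_linear bT.
have [v [s sv]] := svd_exists eP cT.
have sE k : s k = (k.+1%:R)^-1 by rewrite -mT (mu_svd eP k cT sv).
have Tsym := positive_sym Tl pT.
have Tadj : adjoint T = T by exact: adjoint_uniq.
have Tv k : T (v k) = (s k)%:C *: v k.
  apply/eqP; rewrite -subr_eq0; set w := _ - _; apply/eqP.
  (* From T^2 v = s^2 v, the vector w = (T - s) v satisfies (T + s) w = 0;
     positivity excludes the eigenvalue -s, so w = 0. *)
  have Tw : T w = - (s k)%:C *: w.
    have := svd_eigen sv k; rewrite /gram /= Tadj => TT.
    rewrite /w (linB Tl) (linZ Tl) TT expr2 rmorphM -scalerA -scalerBr scaleNr.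
    by rewrite -scalerN opprB.
  have s0 : 0 < s k by rewrite sE invr_gt0 ltr0n.
  have := pT w; rewrite Tw innerZl innerxx mulNr -rmorphM -rmorphN ler0c oppr_ge0.
  rewrite pmulr_rle0// => h; apply/eqP; rewrite -nrm_eq0 -sqrf_eq0.
  by rewrite eq_le h sqr_ge0.
have ov := svd_on sv.
have one_le (k : nat) : cmod ((fun=> 1 : R[i]) k : R[i]) <= 1.
  by rewrite -[1]/(1%:C) cmod_id.
pose V := gdiag e v (fun=> 1).
have bV : bounded_op V := gdiag_bounded eP ov one_le.
have bVa : bounded_op (adjoint V) := adjoint_bounded eP bV.
have Ve k : V (e k) = v k by rewrite /V (gdiag_basis eP) scale1r.
have VV : adjoint V \o V = id.
  apply: (bounded_op_ext eP) => [||k]; [exact: bounded_op_comp|exact: bounded_op_id|].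
  apply/eqP; rewrite -subr_eq0; apply/eqP/(basis_eq0 eP) => j.
  rewrite innerBr /= -(adjointE eP)// !Ve ov (basis_orthonormal eP).
  exact: subrr.
exists V; split=> //.
have TV : T \o V = V \o D.
  apply: (bounded_op_ext eP) => [||k];
    [exact: bounded_op_comp|exact: bounded_op_comp harmD_bounded|].
  by rewrite /= Ve Tv harmD_basis (linZ (bounded_op_linear bV)) Ve sE.
apply/funext => x; rewrite -[RHS]/((V \o D) (adjoint V x)) -TV /=.
apply/eqP; rewrite -subr_eq0 -(linB Tl); apply/eqP.
set y := x - _.
have yv k : inner y (v k) = 0.
  rewrite -Ve -(adjointEr eP bV) /y (linB (bounded_op_linear bVa)).
  by rewrite -[adjoint V (V _)]/((adjoint V \o V) _) VV subrr inner0l.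
apply: nrm_small => eps eps0.
have n1 : 0 < nrm y + 1 by rewrite ltr_wpDl ?nrm_ge0.
have [n sn] := svd_small sv (divr_gt0 eps0 n1).
apply: le_trans (svd_bound sv (n := n) (fun j _ => yv j)) _.
move: sn; rewrite ltr_pdivlMr// => /ltW; apply: le_trans.
by rewrite ler_wpM2l ?(svd_ge0 sv)// lerDl.
Qed.

End Diag.

(** * Traces vanish on commutators *)

Section Neumann.
Context {R : realType} {H : hilbertType R}.
Implicit Types (x y z : H) (T S A : H -> H).

(** The partial sums satisfy u (n+1) = y + A (u n), and their consecutive
    distances halve. *)
Lemma neumann A : linear A -> (forall x, nrm (A x) <= 2^-1 * nrm x) ->
  forall y, exists x, x - A x = y.
Proof.
move=> Al Ah y; pose u n := iter n (fun x => y + A x) 0.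
have d1 n : nrm (u n.+1 - u n) <= nrm y * 2^-1 ^+ n.
  elim: n => [|n IH]; first by rewrite /u /= (lin0 Al) addr0 subr0 expr0 mulr1.
  have -> : u n.+2 - u n.+1 = A (u n.+1 - u n).
    by rewrite (linB Al) /u /= opprD addrACA subrr add0r.
  apply: le_trans (Ah _) _; rewrite exprS mulrCA ler_wpM2l//.
have dm n m : nrm (u (n + m)%N - u n) <= nrm y * (2 * 2^-1 ^+ n - 2 * 2^-1 ^+ (n + m)).
  elim: m => [|m IH]; first by rewrite addn0 !subrr nrm0 mulr0.
  rewrite addnS; have := nrmD (u (n + m).+1 - u (n + m)%N) (u (n + m)%N - u n).
  rewrite addrA subrK => /le_trans; apply.
  apply: le_trans (lerD (d1 _) IH) _; rewrite exprS.
  by rewrite le_eqVlt; apply/orP; left; apply/eqP; field.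
have small (eps : R) : 0 < eps -> exists N, forall n, (N <= n)%N ->
    nrm (u n - u N) < eps.
  move=> e0; have y1 : 0 < 2 * (nrm y + 1) by rewrite mulr_gt0// ltr_wpDl ?nrm_ge0.
  have [N HN] := harm_small (divr_gt0 e0 y1).
  exists N => n Nn; rewrite -(subnKC Nn); apply: le_lt_trans (dm _ _) _.
  have h2 : 2^-1 ^+ N <= (N.+1%:R)^-1 :> R.
    rewrite exprVn lef_pV2 ?posrE ?exprn_gt0 ?ltr0n// -natrX ler_nat.
    exact: ltn_expl.
  have h3 := HN N (leqnn _); rewrite ltr_pdivlMr// in h3.
  have h4 : 0 <= 2^-1 ^+ (N + (n - N)) :> R by rewrite exprn_ge0// invr_ge0.
  have ny := nrm_ge0 y; have h5 : 0 < (N.+1%:R)^-1 :> R by rewrite invr_gt0 ltr0n.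
  apply: le_lt_trans h3.
  apply: (@le_trans _ _ (nrm y * (2 * 2^-1 ^+ N))); first by rewrite ler_wpM2l//; lra.
  apply: (@le_trans _ _ (nrm y * (2 * (N.+1%:R)^-1))).
    by rewrite ler_wpM2l// ler_wpM2l.
  rewrite -subr_ge0 (_ : _ - _ = 2 * (N.+1%:R)^-1); last by ring.
  by rewrite mulr_ge0// ltW.
have ucvg : cvgn u.
  apply: nrm_cauchy => eps e0; have [N HN] := small _ e0.
  by exists (u N), N => // n /= Nn; rewrite nrmB HN.
exists (limn u); apply/eqP; rewrite -subr_eq0; apply/eqP/nrm_small => eps e0.
move/nrm_cvg in ucvg; have [N _ HN] := ucvg _ (divr_gt0 e0 (ltr0Sn R 1)).
have h1 := HN N (leqnn _); have h2 := HN N.+1 (leqnSn _).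
have -> : limn u - A (limn u) - y = (limn u - u N.+1) + A (u N - limn u).
  by rewrite (linB Al) /u /= opprD !addrA addrAC (addrAC _ (- A _) (A _)) subrK addrAC.
apply: le_trans (nrmD _ _) _; have := Ah (u N - limn u).
move: h1 h2; rewrite /= (nrmB (u N)); lra.
Qed.

End Neumann.

Section Trace.
Context {R : realType} {H : hilbertType R} {e : nat -> H}.
Hypothesis eP : orthonormal_basis e.
Implicit Types (x y z : H) (T S A : H -> H).
Variable phi : (H -> H) -> R[i].
Hypothesis tphi : is_trace phi.

Lemma trace_addZ a T S : weak_L1 T -> weak_L1 S -> phi (a *: T + S) = a * phi T + phi S.
Proof. by case: tphi => h _; exact: h. Qed.

Lemma trace_0 : phi 0 = 0.
Proof.
have w0 := weak_L1_0 eP; have := trace_addZ 1 w0 w0.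
by rewrite scale1r addr0 mul1r => h; apply: (@addrI _ (phi 0)); rewrite addr0 -h.
Qed.

Lemma trace_Z a T : weak_L1 T -> phi (a *: T) = a * phi T.
Proof.
move=> wT; have := trace_addZ a wT (weak_L1_0 eP).
by rewrite trace_0 !addr0.
Qed.

Lemma comm_weak T S : weak_L1 T -> bounded_op S -> weak_L1 ((T \o S) - (S \o T)).
Proof.
move=> wT bS; apply: (weak_L1_sub eP); first exact: (weak_L1_compr eP wT bS).
exact: (weak_L1_compl eP bS wT).
Qed.

(** The Cayley transform U = W V^-1 of A, with V = 1 - iA and W = 1 + iA, is
    unitary and conjugates V T W into W T V. *)
Lemma trace_comm_small A T : bounded_op A ->
  (forall x y, inner (A x) y = inner x (A y)) ->
  (forall x, nrm (A x) <= 2^-1 * nrm x) -> weak_L1 T ->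
  phi ((T \o A) - (A \o T)) = 0.
Proof.
move=> bA Asym Ah wT; have Al := bounded_op_linear bA.
pose ii : R[i] := 'i.
have iE : Num.conj ii = - ii by exact: conjCi.
have i2 : ii * ii = -1 by rewrite -expr2 sqrCi.
have i0 : ii != 0 by exact: neq0Ci.
have ni : cmod ii = 1.
  by apply: (@complexI R); rewrite -(@nrmE R R[i]^o) normCi.
pose iA := ii *: A; pose jA := - ii *: A.
have biA : bounded_op iA.
  by rewrite -[iA]addr0; apply: bounded_op_addZ => //; exact: bounded_op0.
have bjA : bounded_op jA.
  by rewrite -[jA]addr0; apply: bounded_op_addZ => //; exact: bounded_op0.
have iAh x : nrm (iA x) <= 2^-1 * nrm x by rewrite /iA fctE nrmZ ni mul1r; exact: Ah.
have jAh x : nrm (jA x) <= 2^-1 * nrm x.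
  by rewrite /jA fctE nrmZ (@nrmN R R[i]^o) ni mul1r; exact: Ah.
pose V x := x - iA x; pose W x := x - jA x.
have bV : bounded_op V.
  have -> : V = -1 *: iA + idfun by apply/funext => x; rewrite !fctE scaleN1r addrC.
  by apply: bounded_op_addZ => //; exact: bounded_op_id.
have bW : bounded_op W.
  have -> : W = -1 *: jA + idfun by apply/funext => x; rewrite !fctE scaleN1r addrC.
  by apply: bounded_op_addZ => //; exact: bounded_op_id.
have VE x : V x = x - ii *: A x by [].
have WE x : W x = x + ii *: A x by rewrite /W /jA fctE scaleNr opprK.
have VW x : V (W x) = W (V x).
  apply: inner_injl => z; rewrite !(VE, WE) !(linD Al, linN Al, linZ Al).
  by rewrite !(innerDl, innerNl, innerZl); ring.
have VadjW x y : inner (V x) y = inner x (W y).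
  rewrite VE WE innerBl innerDr innerZl innerZr iE Asym; ring.
have WadjV x y : inner (W x) y = inner x (V y).
  by rewrite innerC -VadjW -innerC.
have nVW x : nrm (W x) = nrm (V x).
  apply/eqP; rewrite -(@eqrXn2 _ 2)// ?nrm_ge0//; apply/eqP/(@complexI R).
  by rewrite -!innerxx VadjW WadjV VW.
have /choice[Vi ViP] : forall y, exists x, V x = y.
  by move=> y; exact: (neumann (bounded_op_linear biA) iAh).
have /choice[Wi WiP] : forall y, exists x, W x = y.
  by move=> y; exact: (neumann (bounded_op_linear bjA) jAh).
have Vinj x : V x = 0 -> x = 0.
  move=> Vx; apply/eqP; rewrite -nrm_eq0 eq_le nrm_ge0 andbT.
  have := nrmD (V x) (iA x); rewrite subrK Vx nrm0 add0r.
  by have := iAh x; have := nrm_ge0 x; lra.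
have ViV x : Vi (V x) = x.
  apply/eqP; rewrite -subr_eq0; apply/eqP/Vinj.
  by rewrite (linB (bounded_op_linear bV)) ViP subrr.
have WiW x : Wi (W x) = x.
  apply/eqP; rewrite -subr_eq0; apply/eqP/Vinj/eqP; rewrite -nrm_eq0 -nVW nrm_eq0.
  by rewrite (linB (bounded_op_linear bW)) WiP subrr.
pose U := W \o Vi; pose U' := V \o Wi.
have bU : bounded_op U.
  apply/bounded_opP; split; last by exists 1 => // x; rewrite /U /= nVW ViP mul1r.
  move=> a x y; rewrite /U /= -(bounded_op_linear bW); congr W.
  rewrite -[RHS]ViV; congr Vi.
  by rewrite (bounded_op_linear bV) !ViP.
have UU' : adjoint U = U'.
  apply: adjoint_uniq => x y; rewrite /U /U' /=.
  by rewrite -{2}(ViP x) -{1}(WiP y) VadjW WadjV VW.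
have uU : unitary_op U.
  split=> //; rewrite UU'; apply/funext => x; rewrite /U /U' /=.
    by rewrite -[in LHS](WiP x) WiW -[X in Vi (V X)]WiW ViV WiP.
  by rewrite -[in LHS](ViP x) ViV -[X in Wi (W X)]ViV WiW ViP.
have wVTW : weak_L1 (V \o T \o W).
  by apply: (weak_L1_compr eP) => //; exact: (weak_L1_compl eP).
have := tphi.2 U _ uU wVTW; rewrite UU'.
have Tl := bounded_op_linear (weak_L1_bounded wT).
have wC : weak_L1 ((T \o A) - (A \o T)) by exact: comm_weak.
have -> : U \o (V \o T \o W) \o U' =
    (- (2 * ii)) *: ((T \o A) - (A \o T)) + (V \o T \o W).
  apply/funext => x; rewrite /U /U' !fctE /= ViV -VW WiP.
  apply: inner_injl => z.
  rewrite !(VE, WE) !(linD Tl, linN Tl, linZ Tl).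
  rewrite !(linD Al, linN Al, linZ Al) !(innerDl, innerNl, innerZl, innerBl).
  ring.
rewrite (trace_addZ _ wC wVTW) => /eqP; rewrite -subr_eq0 addrK mulf_eq0.
move=> /orP[|/eqP//].
by rewrite oppr_eq0 mulf_eq0 pnatr_eq0 (negbTE i0).
Qed.

(** The commutator is linear in A, so A may be scaled down to norm at most 1/2. *)
Lemma trace_comm_sa A T : bounded_op A ->
  (forall x y, inner (A x) y = inner x (A y)) -> weak_L1 T ->
  phi ((T \o A) - (A \o T)) = 0.
Proof.
move=> /[dup] bA /bounded_opP[Al [M M0 AM]] Asym wT.
pose c : R := (2 * (M + 1))^-1.
have c0 : 0 < c by rewrite invr_gt0 mulr_gt0// ltr_wpDl.
have Tl := bounded_op_linear (weak_L1_bounded wT).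
have wC : weak_L1 ((T \o A) - (A \o T)) by exact: comm_weak.
have bcA : bounded_op (c%:C *: A).
  by rewrite -[_ *: A]addr0; apply: bounded_op_addZ => //; exact: bounded_op0.
have : phi ((T \o (c%:C *: A)) - ((c%:C *: A) \o T)) = 0.
  apply: trace_comm_small => //.
    by move=> x y; rewrite !fctE innerZl innerZr conjR Asym.
  move=> x; rewrite fctE nrmZ cmod_id ?(ltW c0)//.
  rewrite (le_trans (ler_wpM2l (ltW c0) (AM x)))//.
  rewrite mulrA ler_wpM2r ?nrm_ge0// /c invfM -mulrA -[leRHS]mulr1 ler_wpM2l//.
  by rewrite mulrC ler_pdivrMr ?mul1r ?lerDl// ltr_wpDl.
have -> : (T \o (c%:C *: A)) - ((c%:C *: A) \o T) = c%:C *: ((T \o A) - (A \o T)).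
  by apply/funext => x; rewrite !fctE /= (linZ Tl) scalerBr.
rewrite trace_Z// => /eqP; rewrite mulf_eq0 => /orP[|/eqP//].
by rewrite -[0]/(0%:C) (inj_eq (@complexI R)) gt_eqF.
Qed.

(** S is a combination of the self-adjoint operators S + S^* and i (S^* - S). *)
Lemma trace_comm T S : weak_L1 T -> bounded_op S -> phi ((T \o S) - (S \o T)) = 0.
Proof.
move=> wT bS; have bSa := adjoint_bounded eP bS.
have Tl := bounded_op_linear (weak_L1_bounded wT).
have SE := adjointE eP bS; have SEr := adjointEr eP bS.
pose ii : R[i] := 'i.
have iE : Num.conj ii = - ii by exact: conjCi.
have i2 : ii * ii = -1 by rewrite -expr2 sqrCi.
pose A := 1 *: S + adjoint S; pose B := ii *: (-1 *: S + adjoint S) + 0.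
have bA : bounded_op A by exact: bounded_op_addZ.
have bB : bounded_op B.
  by apply: bounded_op_addZ; [exact: bounded_op_addZ|exact: bounded_op0].
have hA : phi ((T \o A) - (A \o T)) = 0.
  apply: trace_comm_sa => // x y; rewrite /A !fctE !scale1r innerDl innerDr SE SEr.
  exact: addrC.
have hB : phi ((T \o B) - (B \o T)) = 0.
  apply: trace_comm_sa => // x y; rewrite /B !fctE !addr0 innerZl innerZr iE.
  by rewrite !scaleN1r !innerDl !innerDr innerNl innerNr SE SEr; ring.
have wA := comm_weak wT bA; have wB := comm_weak wT bB.
have -> : (T \o S) - (S \o T) = (2^-1 : R[i]) *: ((T \o A) - (A \o T)) +
    (2^-1 * ii) *: ((T \o B) - (B \o T)).
  apply/funext => x; apply: inner_injl => z; rewrite /A /B !fctE /= !addr0.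
  rewrite !(linD Tl, linN Tl, linZ Tl).
  rewrite !(innerDl, innerNl, innerZl, innerBl).
  set a := inner _ _; set b := inner _ _; set c := inner _ _; set d := inner _ _.
  have -> : 2^-1 * ii * (ii * (-1 * a + c) - ii * (-1 * b + d)) =
     2^-1 * (ii * ii) * ((-1 * a + c) - (-1 * b + d)) by ring.
  by rewrite i2; field.
rewrite trace_addZ//; last exact: (weak_L1_Z eP _ wB).
by rewrite trace_Z// hA hB !mulr0 addr0.
Qed.

Lemma trace_commutator_space X :
  commutator_space weak_L1 bounded_op X -> weak_L1 X /\ phi X = 0.
Proof.
move=> [n [v [c [vc ->]]]].
apply: (big_ind (fun Y => weak_L1 Y /\ phi Y = 0)) => [|X1 X2 [w1 h1] [w2 h2]|i _].
- by split; [exact: (weak_L1_0 eP)|exact: trace_0].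
- split; first exact: (weak_L1_add eP w1 w2).
  by rewrite -[X1]scale1r trace_addZ// h1 h2 mulr0 addr0.
- have [T wT [S bS <-]] := vc i; have wC := comm_weak wT bS.
  by split; [exact: (weak_L1_Z eP _ wC)|rewrite trace_Z// trace_comm// mulr0].
Qed.

End Trace.

(** * Functionals that vanish on a subspace *)

Section Span.
Context {K : numFieldType} {V : lmodType K} (A : set V).

Lemma linspan_addZ (a : K) x y : linspan A x -> linspan A y -> linspan A (a *: x + y).
Proof.
move=> [m [u [c [uA ->]]]] [n [v [d [vA ->]]]].
exists (m + n)%N, (fun i => match fintype.split i with inl j => u j | inr j => v j end),
  (fun i => match fintype.split i with inl j => a * c j | inr j => d j end); split.
  by move=> i; case: fintype.split => j.
rewrite big_split_ord/= scaler_sumr; congr (_ + _); apply: eq_bigr => i _.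
  by rewrite (unsplitK (inl i)) scalerA.
by rewrite (unsplitK (inr i)).
Qed.

Lemma linspan_mem x : A x -> linspan A x.
Proof.
move=> Ax; exists 1%N, (fun=> x), (fun=> 1); split=> //.
by rewrite big_ord1 scale1r.
Qed.

Lemma linspan_0 : linspan A 0.
Proof.
exists 0%N, (fun=> 0), (fun=> 0); split; last by rewrite big_ord0.
by case.
Qed.

End Span.

Section Separation.
Context {K : numFieldType} {V : lmodType K}.

Definition linear_subspace (A : set V) :=
  A 0 /\ forall a x y, A x -> A y -> A (a *: x + y).

(** A maximal subspace A containing W but not x is a complement of the line of x,
    by maximality; f reads off the coefficient of x. *)
Lemma linear_separation (W : set V) x : linear_subspace W -> ~ W x ->
  exists f : V -> K, [/\ forall a u v, f (a *: u + v) = a * f u + f v,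
    forall w, W w -> f w = 0 & f x = 1].
Proof.
move=> sW nWx.
pose P := [set A : set V | A = set0 \/ [/\ W `<=` A, linear_subspace A & ~ A x]].
(* The empty set is admitted in P so that the union of the empty chain is in P; a
   maximal element is not empty, since W is larger. *)
have [F FP Ftot|A [PA Amax]] := @Zorn_bigcup V P.
  have [[X FX /set0P X0]|nX] := pselect (exists2 X, F X & X != set0); last first.
    left; apply/seteqP; split=> // y [X FX Xy]; apply: nX.
    by exists X => //; apply/set0P; exists y.
  have FP' Y y : F Y -> Y y -> [/\ W `<=` Y, linear_subspace Y & ~ Y x].
    by move=> FY Yy; have [Y0|//] := FP _ FY; rewrite Y0 in Yy.
  right; have [y Xy] := X0; have [WX [X00 _] _] := FP' X y FX Xy.
  split.
  - by move=> w Ww; exists X => //; exact: WX.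
  - split; first by exists X.
    move=> a u v [Y FY Yu] [Z FZ Zv].
    have [YZ|ZY] := Ftot _ _ FY FZ.
      by exists Z => //; have [_ [_ h] _] := FP' _ _ FZ Zv; apply: h => //; exact: YZ.
    by exists Y => //; have [_ [_ h] _] := FP' _ _ FY Yu; apply: h => //; exact: ZY.
  - by move=> [Y FY Yx]; have [] := FP' _ _ FY Yx.
have [WA [A0 Aadd] nAx] : [/\ W `<=` A, linear_subspace A & ~ A x].
  case: PA => // A0; exfalso; apply: (Amax W); last by right; split.
  by rewrite A0; split=> // h; have [W0 _] := sW; exact: h 0 W0.
have AZ a u : A u -> A (a *: u) by move=> Au; rewrite -[_ *: _]addr0; exact: Aadd.
have AD u v : A u -> A v -> A (u + v) by move=> Au; rewrite -[u]scale1r; exact: Aadd.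
have /choice[f fA] : forall v, exists a, A (v - a *: x).
  move=> v; have [Av|nAv] := pselect (A v); first by exists 0; rewrite scale0r subr0.
  pose B := [set y | exists b w, A w /\ y = b *: v + w].
  have /contrapT Bx : ~ ~ B x.
    move=> nBx; apply: (Amax B); last right.
      split; first by move=> w Aw; exists 0, w; rewrite scale0r add0r.
      move=> /(_ v) h; apply: nAv; apply: h; exists 1, 0; split=> //.
      by rewrite scale1r addr0.
    split=> //; first by move=> w /WA Aw; exists 0, w; rewrite scale0r add0r.
    split; first by exists 0, 0; rewrite scale0r addr0.
    move=> a _ _ [b [w [Aw ->]]] [c [z [Az ->]]].
    exists (a * b + c), (a *: w + z); split; first exact: Aadd.
    by rewrite scalerDr scalerDl scalerA addrACA.
  have [b [w [Aw xE]]] := Bx.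
  have b0 : b != 0.
    by apply/eqP => b0; apply: nAx; rewrite xE b0 scale0r add0r.
  exists b^-1; rewrite xE scalerDr scalerA mulVf// scale1r opprD addrA subrr add0r.
  by rewrite -scaleNr; exact: AZ.
have fu v a : A (v - a *: x) -> f v = a.
  move=> va; apply/eqP; rewrite -subr_eq0; apply: contrapT => /negP d0.
  apply: nAx; have -> : x = (f v - a)^-1 *: ((v - a *: x) + -1 *: (v - f v *: x)).
    have -> : (v - a *: x) + -1 *: (v - f v *: x) = (f v - a) *: x.
      by rewrite scaleN1r opprB addrC addrA subrK scalerBl.
    by rewrite scalerA mulVf// scale1r.
  by apply: (AZ); apply: AD => //; exact: AZ.
exists f; split.
- move=> a u v; apply: fu.
  have -> : a *: u + v - (a * f u + f v) *: x = a *: (u - f u *: x) + (v - f v *: x).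
    by rewrite scalerDl opprD scalerBr scalerA addrACA.
  exact: Aadd.
- by move=> w Ww; apply: fu; rewrite scale0r subr0; exact: WA.
- by apply: fu; rewrite scale1r subrr.
Qed.

End Separation.

(** * Finite traces of commutators *)

Section GramSchmidt.
Context {R : realType} {H : hilbertType R}.
Implicit Types (x y z : H) (u p : seq H).

Definition orthonormal_seq u := orthonormal_family (fun i : 'I_(size u) => u`_i).

Definition proj u x := \sum_(i < size u) inner x u`_i *: u`_i.

Lemma proj_orth u x : orthonormal_seq u -> orth_to u (x - proj u x).
Proof.
move=> ou w /(nthP 0)[i iu <-]; rewrite innerBl /proj.
rewrite (orthonormal_inner_sum (r := index_enum _) (fun i : 'I_(size u) => inner x u`_i)
  (Ordinal iu) ou (index_enum_uniq _)).
by rewrite mem_index_enum subrr.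
Qed.

Lemma proj_nrm u x : orthonormal_seq u -> nrm (x - proj u x) <= nrm x.
Proof.
move=> ou; rewrite -(@ler_pXn2r _ 2)// ?nnegrE ?nrm_ge0//.
rewrite (bessel_split (r := index_enum _) x ou (index_enum_uniq _)) lerDl.
by apply: sumr_ge0 => i _; exact: sqr_ge0.
Qed.

Lemma proj_sym u x y : inner (proj u x) y = inner x (proj u y).
Proof.
rewrite /proj inner_suml inner_sumr; apply: eq_bigr => i _.
by rewrite innerZl innerZr mulrC -innerC.
Qed.

Lemma orth_proj u x y : orth_to u x -> inner x (proj u y) = 0.
Proof.
move=> xu; rewrite /proj inner_sumr big1// => i _.
by rewrite innerZr xu ?mulr0// mem_nth.
Qed.

Lemma orthonormal_seq_rcons u r :
  orthonormal_seq u -> orth_to u r -> nrm r = 1 ->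
  orthonormal_seq (rcons u r).
Proof.
move=> ou ur r1 [i/= ip] [j/= jp]; rewrite -val_eqE /= !nth_rcons.
move: ip jp; rewrite size_rcons !ltnS => ip jp.
move: ip; rewrite leq_eqVlt => /orP[/eqP ->|ip];
  move: jp; rewrite leq_eqVlt => /orP[/eqP ->|jp]; rewrite ?ltnn ?eqxx.
- by rewrite innerxx r1 expr1n.
- by rewrite jp ur ?mem_nth// gtn_eqF.
- by rewrite ip innerC ur ?mem_nth// rmorph0 ltn_eqF.
- by rewrite ip jp; have := ou (Ordinal ip) (Ordinal jp).
Qed.

(** Extends u without changing it: the trace estimate needs the family to start
    with given basis vectors. *)
Lemma gram_schmidt u p : orthonormal_seq u -> exists u', [/\ orthonormal_seq (u ++ u'),
  (size u' <= size p)%N & forall x, orth_to (u ++ u') x -> orth_to p x].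
Proof.
elim: p u => [|l p IH] u ou; first by exists [::]; rewrite cats0.
pose r := l - proj u l; have ur := proj_orth l ou.
have [r0|r0] := eqVneq r 0.
  have [u' [ou' su' h]] := IH u ou; exists u'; split=> //; first exact: leqW.
  move=> x xu w; rewrite inE => /orP[/eqP ->|]; last exact: (h x xu).
  have -> : l = proj u l by apply/eqP; rewrite -subr_eq0; apply/eqP.
  by apply: orth_proj => z zu; apply: xu; rewrite mem_cat zu.
have nr : 0 < nrm r by rewrite lt_def nrm_ge0 nrm_eq0 r0.
pose r1 := (nrm r)^-1%:C *: r.
have or1 : orthonormal_seq (rcons u r1).
  apply: orthonormal_seq_rcons => //; first by move=> w wu; rewrite innerZl ur// mulr0.
  by rewrite nrmZ cmod_id ?invr_ge0 ?(ltW nr)// mulVf// gt_eqF.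
have [u' [ou' su' h]] := IH _ or1; exists (r1 :: u').
rewrite cat_rcons in ou' h; split=> // x xu w.
rewrite inE => /orP[/eqP ->|]; last exact: (h x xu).
have -> : l = (nrm r)%:C *: r1 + proj u l.
  by rewrite /r1 scalerA -rmorphM mulfV ?gt_eqF// scale1r subrK.
rewrite innerDr innerZr xu; last by rewrite mem_cat inE eqxx orbT.
rewrite mulr0 add0r; apply: orth_proj => z zu.
by apply: xu; rewrite mem_cat zu.
Qed.

End GramSchmidt.

Section TraceEstimate.
Context {R : realType} {H : hilbertType R} {e : nat -> H}.
Hypothesis eP : orthonormal_basis e.
Implicit Types (x y z : H) (T S : H -> H).

(** The trace of the compression of T to the span of u, when u is orthonormal. *)
Definition ptrace (u : seq H) T := \sum_(i < size u) inner (T u`_i) u`_i.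

(** If y is orthogonal to T p, then T^* y is orthogonal to p, and nrm (T^* y)^2 =
    <T T^* y, y>. *)
Lemma approx_adjoint T (p : seq H) (c : R) : bounded_op T -> 0 <= c ->
  (forall x, orth_to p x -> nrm (T x) <= c * nrm x) ->
  forall y, orth_to (map T p) y -> nrm (adjoint T y) <= c * nrm y.
Proof.
move=> bT c0 Tp y yp.
have [->|a0] := eqVneq (adjoint T y) 0; first by rewrite nrm0 mulr_ge0 ?nrm_ge0.
have ap : orth_to p (adjoint T y).
  by move=> w wp; rewrite (adjointEr eP)// yp// map_f.
rewrite -(@ler_pM2r _ (nrm (adjoint T y))) ?lt_def ?nrm_eq0 ?a0 ?nrm_ge0//.
rewrite -expr2 -[leLHS]cmod_id ?sqr_ge0// -innerxx -(adjointE eP)//.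
rewrite (le_trans (cauchy_schwarz _ _))// mulrAC ler_wpM2r ?nrm_ge0//.
exact: Tp.
Qed.

(** Let P be the projection on the span of u. The compressions P T P and P S P
    are finite matrices, whose commutator has trace 0. What remains are the
    diagonal entries of T (1 - P) S and of S (1 - P) T, each at most c * M. *)
Lemma ptrace_comm T S (u : seq H) (c M : R) : bounded_op T -> bounded_op S ->
  orthonormal_seq u -> 0 <= c -> 0 <= M ->
  (forall x, orth_to u x -> nrm (T x) <= c * nrm x) ->
  (forall x, orth_to u x -> nrm (adjoint T x) <= c * nrm x) ->
  (forall x, nrm (S x) <= M * nrm x) ->
  (forall x, nrm (adjoint S x) <= M * nrm x) ->
  cmod (ptrace u ((T \o S) - (S \o T))) <= (size u)%:R * (2 * (c * M)).
Proof.
move=> bT bS ou c0 M0 Tu Tau SM SaM.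
pose r i := inner (T (S u`_i - proj u (S u`_i))) u`_i.
pose r' i := inner (S (T u`_i - proj u (T u`_i))) u`_i.
have nu (i : 'I_(size u)) : nrm u`_i = 1 by exact: (orthonormal_nrm i ou).
(* Insert 1 = P + (1 - P) between A and B. *)
have expand A B (bA : bounded_op A) i : inner (A (B u`_i)) u`_i =
    \sum_(j < size u) inner (B u`_i) u`_j * inner (A u`_j) u`_i
    + inner (A (B u`_i - proj u (B u`_i))) u`_i.
  have Al := bounded_op_linear bA.
  rewrite (linB Al) innerBl addrC -[LHS](subrK (inner (A (proj u (B u`_i))) u`_i)).
  congr (_ + _); rewrite /proj (lin_sum Al) inner_suml; apply: eq_bigr => j _.
  by rewrite (linZ Al) innerZl.
have -> : ptrace u ((T \o S) - (S \o T)) = \sum_(i < size u) (r i - r' i).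
  rewrite /ptrace; under eq_bigr => i _ do
    rewrite !fctE /= innerBl (expand T S bT) (expand S T bS) opprD addrACA.
  rewrite big_split/= -[RHS]add0r; congr (_ + _).
  rewrite sumrB; apply/eqP; rewrite subr_eq0; apply/eqP.
  rewrite exchange_big/=; apply: eq_bigr => i _; apply: eq_bigr => j _.
  exact: mulrC.
apply: le_trans (@nrm_sum R R[i]^o _ _ _ _) _.
rewrite -[X in X%:R]card_ord mulr_natl -sumr_const.
apply: ler_sum => i _; apply: le_trans (@nrmD R R[i]^o _ _) _.
rewrite (@nrmN R R[i]^o) mulr_natl mulr2n; apply: lerD.
  apply: le_trans (cauchy_schwarz _ _) _; rewrite nu mulr1.
  apply: le_trans (Tu _ (proj_orth _ ou)) _; rewrite ler_wpM2l//.
  by apply: le_trans (proj_nrm _ ou) _; rewrite (le_trans (SM _))// nu mulr1.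
pose q := adjoint S u`_i - proj u (adjoint S u`_i).
have -> : r' i = inner u`_i (adjoint T q).
  rewrite -(adjointE eP)// /r' (adjointE eP)// /q innerBl innerBr.
  by rewrite proj_sym.
apply: le_trans (cauchy_schwarz _ _) _; rewrite nu mul1r.
apply: le_trans (Tau _ (proj_orth _ ou)) _; rewrite ler_wpM2l//.
by apply: le_trans (proj_nrm _ ou) _; rewrite (le_trans (SaM _))// nu mulr1.
Qed.

End TraceEstimate.

(** * The harmonic diagonal operator is not a sum of commutators *)

Section Main.
Context {R : realType} {H : hilbertType R} {e : nat -> H}.
Hypothesis eP : orthonormal_basis e.
Implicit Types (x y z : H) (T S : H -> H).
Local Notation D := (diag e (fun k => (k.+1%:R)^-1)).
Local Notation Comm := (commutator_space (@weak_L1 R H) (@bounded_op R H)).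

Lemma ptrace_sum u (I : finType) (c : I -> R[i]) (X : I -> H -> H) :
  ptrace u (\sum_i c i *: X i) = \sum_i c i * ptrace u (X i).
Proof.
rewrite /ptrace; under [RHS]eq_bigr => i _ do rewrite mulr_sumr.
rewrite exchange_big/=; apply: eq_bigr => j _.
by rewrite fct_sumE inner_suml; apply: eq_bigr => i _; rewrite fctE innerZl.
Qed.

(** D is positive, so the vectors of u' only add to the trace. *)
Lemma ptrace_harmD n u' :
  \sum_(k < n) (k.+1%:R)^-1 <= cmod (ptrace (mkseq e n ++ u') D).
Proof.
set u := _ ++ _.
have pos (i : nat) : 0 <= inner (D u`_i) u`_i by exact: (harmD_positive eP).
have su : size u = (n + size u')%N by rewrite size_cat size_mkseq.
have h : ((\sum_(k < n) (k.+1%:R)^-1 : R)%:C : R[i]) <= ptrace u D.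
  rewrite /ptrace -(big_mkord xpredT (fun i => inner (D u`_i) u`_i)) su.
  rewrite (@big_cat_nat _ _ _ n)//= ?leq_addr//.
  rewrite -[leLHS]addr0; apply: lerD; last by apply: sumr_ge0.
  rewrite big_mkord rmorph_sum/=; apply: ler_sum => k _.
  rewrite /u nth_cat size_mkseq ltn_ord nth_mkseq// (harmD_basis eP) innerZl.
  by rewrite (basis_orthonormal eP) eqxx mulr1.
rewrite -lecR -(@nrmE R R[i]^o); apply: le_trans h _.
by rewrite [leRHS]ger0_norm// sumr_ge0.
Qed.

Lemma harmonic_unbounded (K : R) : exists n, K < \sum_(k < n) (k.+1%:R)^-1.
Proof.
apply: contrapT => /forallNP h; apply: (@dvg_harmonic R).
apply: nondecreasing_is_cvgn.
  by apply: nondecreasing_series => k _ _; rewrite invr_ge0.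
exists K => _ [n _ <-]; rewrite /series /= big_mkord leNgt; apply/negP.
exact: h.
Qed.

(** One list of vectors that serves both T and its adjoint. *)
Lemma weak_L1_testing T : weak_L1 T -> exists C, 0 <= C /\
  forall n, exists p : seq H, (size p <= 2 * n)%N /\ forall x, orth_to p x ->
    nrm (T x) <= C / n.+1%:R * nrm x /\ nrm (adjoint T x) <= C / n.+1%:R * nrm x.
Proof.
move=> /[dup] wT /(weak_L1P eP)[cT [C C0 TC]]; have bT := compact_op_bounded cT.
exists C; split=> // m; have [p pm pT] := TC m.
exists (p ++ map T p); split; first by rewrite size_cat size_map addnn -mul2n leq_mul2l.
move=> x xp; split.
  by apply: pT => w wp; apply: xp; rewrite mem_cat wp.
apply: (approx_adjoint eP bT _ pT); first by rewrite divr_ge0.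
by move=> w wp; apply: xp; rewrite mem_cat wp orbT.
Qed.

(** Take u orthonormal, starting with e 0, ..., e (n-1) and containing in its
    span the test vectors of all m operators: it has at most n + 2 m n
    vectors, so each commutator has ptrace bounded independently of n, while
    that of D is at least the n-th harmonic number. *)
Lemma harmD_not_commutators : ~ Comm D.
Proof.
move=> [m [v [c [vc DE]]]].
have /choice[TS TSP] : forall i, exists TS : (H -> H) * (H -> H),
    [/\ weak_L1 TS.1, bounded_op TS.2 & v i = (TS.1 \o TS.2) - (TS.2 \o TS.1)].
  by move=> i; have [T wT [S bS <-]] := vc i; exists (T, S).
have /choice[C CP] : forall i, exists C : R, 0 <= C /\
    forall n, exists p : seq H, (size p <= 2 * n)%N /\ forall x, orth_to p x ->
      nrm ((TS i).1 x) <= C / n.+1%:R * nrm x /\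
      nrm (adjoint (TS i).1 x) <= C / n.+1%:R * nrm x.
  by move=> i; have [wT _ _] := TSP i; exact: weak_L1_testing wT.
have /choice[M MP] : forall i, exists M : R, [/\ 0 <= M,
    forall x, nrm ((TS i).2 x) <= M * nrm x &
    forall x, nrm (adjoint (TS i).2 x) <= M * nrm x].
  move=> i; have [_ bS _] := TSP i.
  have /bounded_opP[_ [M M0 SM]] := bS.
  have /bounded_opP[_ [N N0 SN]] := adjoint_bounded eP bS.
  exists (M + N); split; first exact: addr_ge0.
    by move=> x; rewrite (le_trans (SM x))// ler_wpM2r ?nrm_ge0// lerDl.
  by move=> x; rewrite (le_trans (SN x))// ler_wpM2r ?nrm_ge0// lerDr.
(* The factor 1 + 2 m bounds (size u) / (n + 1). *)
pose K := \sum_i cmod (c i) * ((1 + 2 * m)%:R * (2 * (C i * M i))).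
have [n Kn] := harmonic_unbounded K.
have /choice[p pP] : forall i, exists p : seq H, (size p <= 2 * n)%N /\
    forall x, orth_to p x -> nrm ((TS i).1 x) <= C i / n.+1%:R * nrm x /\
      nrm (adjoint (TS i).1 x) <= C i / n.+1%:R * nrm x.
  by move=> i; have [_ h] := CP i; exact: h.
pose L := flatten [seq p i | i <- enum 'I_m].
have sL : (size L <= m * (2 * n))%N.
  rewrite /L size_flatten /shape -map_comp sumnE big_map big_enum /=.
  apply: (@leq_trans (\sum_(i < m) 2 * n)%N).
    by apply: leq_sum => i _; have [] := pP i.
  by rewrite sum_nat_const card_ord.
have one : orthonormal_seq (mkseq e n).
  move=> [i ip] [j jp]; rewrite -val_eqE /=; move: ip jp; rewrite size_mkseq => ip jp.
  by rewrite !nth_mkseq//; exact: (basis_orthonormal eP).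
have [u' [ou su' uL]] := gram_schmidt L one.
set u := mkseq e n ++ u' in ou uL.
have su : (size u <= n + m * (2 * n))%N.
  by rewrite size_cat size_mkseq leq_add2l (leq_trans su').
have up i x : orth_to u x -> orth_to (p i) x.
  move=> xu w wp; apply: (uL x xu); apply/flattenP; exists (p i) => //.
  by apply: map_f; rewrite mem_enum.
have := ptrace_harmD n u'; rewrite leNgt => /negP; apply; apply: le_lt_trans Kn.
rewrite -/u [in ptrace u _]DE ptrace_sum; apply: le_trans (@nrm_sum R R[i]^o _ _ _ _) _.
apply: ler_sum => i _; rewrite cmodM ler_wpM2l ?nrm_ge0//.
have [wT bS ->] := TSP i; have [M0 SM SaM] := MP i; have [C0 _] := CP i.
have [_ Tp] := pP i.
have c0 : 0 <= C i / n.+1%:R by rewrite divr_ge0.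
have := @ptrace_comm _ _ _ eP _ _ u _ _ (weak_L1_bounded wT) bS ou c0 M0
  (fun x xu => (Tp x (up i x xu)).1) (fun x xu => (Tp x (up i x xu)).2) SM SaM.
move=> /le_trans; apply.
have -> : (size u)%:R * (2 * (C i / n.+1%:R * M i)) =
    (size u)%:R / n.+1%:R * (2 * (C i * M i)) by ring.
rewrite ler_wpM2r ?mulr_ge0// ler_pdivrMr ?ltr0n// -natrM ler_nat.
apply: leq_trans su _; rewrite mulnDl mul1n leq_add// -mulnA mulnCA leq_mul2l.
by rewrite leq_mul2l leqnSn !orbT.
Qed.

(** * Functionals that vanish on commutators *)

Lemma commutators_comm T S : weak_L1 T -> bounded_op S -> Comm ((T \o S) - (S \o T)).
Proof. by move=> wT bS; apply: linspan_mem; exists T => //; exists S. Qed.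

Lemma commutators_subspace : linear_subspace Comm.
Proof. by split=> [|a x y]; [exact: linspan_0|exact: linspan_addZ]. Qed.

(** U T U^* - T is the commutator of U with T U^*. *)
Lemma vanishing_is_trace (f : (H -> H) -> R[i]) :
  (forall a u v, f (a *: u + v) = a * f u + f v) -> (forall w, Comm w -> f w = 0) ->
  is_trace f.
Proof.
move=> fl fC; split=> [a T S _ _|U T uU wT]; first exact: fl.
have [bU UUa UaU] := uU; have bUa := adjoint_bounded eP bU.
have wTU : weak_L1 (T \o adjoint U) by exact: (weak_L1_compr eP).
have -> : U \o T \o adjoint U =
    -1 *: (((T \o adjoint U) \o U) - (U \o (T \o adjoint U))) + T.
  apply/funext => x; rewrite !fctE scaleN1r opprB.
  have -> : adjoint U (U x) = x by exact: (congr1 (fun g => g x) UaU).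
  by rewrite subrK.
by rewrite fl (fC _ (commutators_comm wTU bU)) mulr0 add0r.
Qed.

(** With T = V D V^* and V an isometry, T - D is the commutator of V with D V^*. *)
Lemma vanishing_is_normalised (f : (H -> H) -> R[i]) :
  (forall a u v, f (a *: u + v) = a * f u + f v) -> (forall w, Comm w -> f w = 0) ->
  f D = 1 -> normalised f.
Proof.
move=> fl fC fD T wT pT mT.
have [V [bV VV TE]] := harmonic_structure eP wT pT mT.
have bVa := adjoint_bounded eP bV.
have wDV : weak_L1 (D \o adjoint V) by exact: (weak_L1_compr eP (harmD_weak eP)).
have -> : T = -1 *: (((D \o adjoint V) \o V) - (V \o (D \o adjoint V))) + D.
  rewrite TE; apply/funext => x; rewrite !fctE scaleN1r opprB.
  have -> : adjoint V (V x) = x by exact: (congr1 (fun g => g x) VV).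
  by rewrite subrK.
by rewrite fl (fC _ (commutators_comm wDV bV)) mulr0 add0r.
Qed.

End Main.

Theorem lemma4 (R : realType) (H : hilbertType R)
    (sepH : separable H) (infH : infinite_dimensional H)
    (e : nat -> H) (eP : orthonormal_basis e)
    (T : H -> H) (TL : weak_L1 T) (z : R[i]) :
  (forall phi : (H -> H) -> R[i],
     is_trace phi -> normalised phi -> phi T = z) <->
  commutator_space weak_L1 bounded_op
    (T - z *: diag e (fun k => (k.+1%:R)^-1)).
Proof.
set D := diag _ _.
split=> [hT|hC phi tphi nphi]; last first.
  have wD := harmD_weak eP.
  have [wX pX] := trace_commutator_space eP tphi hC.
  have -> : T = z *: D + (T - z *: D) by rewrite addrC subrK.
  rewrite (trace_addZ tphi z wD wX) pX addr0 nphi ?mulr1//.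
    exact: (harmD_positive eP).
  exact: (harmD_mu eP).
have [f0 [f0l f0C f0D]] := linear_separation (commutators_subspace (H := H))
  (harmD_not_commutators eP).
have f0T : f0 T = z.
  by apply: hT; [exact: (vanishing_is_trace eP)|exact: (vanishing_is_normalised eP)].
apply: contrapT => nC.
have [f1 [f1l f1C f1X]] := linear_separation (commutators_subspace (H := H)) nC.
(* The correction keeps the value of f1 at T - z D, because f0 vanishes there,
   and makes f equal to 1 at D. *)
pose f X := f0 X + (f1 X - f1 D * f0 X).
have fl a u v : f (a *: u + v) = a * f u + f v.
  by rewrite /f f0l f1l; ring.
have fC w : commutator_space weak_L1 bounded_op w -> f w = 0.
  by move=> wC; rewrite /f f0C// f1C// mulr0 subr0 addr0.
have fD : f D = 1 by rewrite /f f0D mulr1 subrr addr0.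
have fT : f T = z.
  by apply: hT; [exact: (vanishing_is_trace eP)|exact: (vanishing_is_normalised eP)].
have f1T : f1 T = 1 + z * f1 D.
  have := f1X; have -> : T - z *: D = - z *: D + T by rewrite scaleNr addrC.
  by rewrite f1l mulNr => <-; rewrite addrAC addNr add0r.
move: fT; rewrite /f f0T f1T => /eqP.
have -> : z + (1 + z * f1 D - f1 D * z) = z + 1 by ring.
by rewrite -subr_eq0 addrAC subrr add0r oner_eq0.
Qed.
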